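(* Let $m,n\in\mathbb{N}$, $m\geq 1$, and let $f:\mathbb{R}^m\to\mathbb{R}$ be a given function. Then there exists an algorithm with runtime complexity $O\big(N(m,n)^2\big)$, requiring storage in $O\big(mN(m,n)\big)$, that computes: (i) a generic node set $P\subseteq\mathbb{R}^m$ with respect to $m,n$; (ii) a polynomial $Q\in\mathbb{R}[x_1,\dots,x_m]$ with $\deg(Q)\leq n$ such that $Q$ is the unique solution of the polynomial interpolation problem with respect to $f$ and $P'=P+\mu$, where $P$ is the set generated in (i) and $\mu\in\mathbb{R}^m$ is an arbitrary vector; that is, $Q$ is the unique polynomial of degree at most $n$ with $Q(p)=f(p)$ for all $p\in P'$.
   Context: Here $0\in\mathbb{N}$ and $N(m,n):=\binom{m+n}{m}$, the number of monomials of degree at most $n$ in $m$ variables. A set $P=\{p_1,\dots,p_{N(m,n)}\}\subseteq\mathbb{R}^m$ of $N(m,n)$ nodes is called generic with respect to $m,n$ if the multivariate Vandermonde matrix $V_{m,n}(P)\in\mathbb{R}^{N(m,n)\times N(m,n)}$, whose $i$-th row consists of the values at $p_i$ of all monomials $x_1^{i_1}\cdots x_m^{i_m}$ with $i_1+\dots+i_m\leq n$ (in a fixed order), is regular (invertible). $P+\mu=\{p+\mu : p\in P\}$. A polynomial is computed by computing its coefficients. Complexity is measured in the model where the value $f(x)$ at any $x\in\mathbb{R}^m$ can be evaluated in $O(1)$ time and each (real/floating-point) arithmetic operation takes $O(1)$ time; storage counts the number of stored numbers. The $O$-bounds have absolute constants, independent of $m$, $n$, $f$ and $\mu$. *)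

(* Defs.v *)
From mathcomp Require Import all_boot all_order all_algebra.
From mathcomp Require Import reals.
From mathcomp Require Import mpoly.

Set Implicit Arguments.
Unset Strict Implicit.
Unset Printing Implicit Defensive.

Import Order.TTheory GRing.Theory Num.Theory.
Local Open Scope ring_scope.

Definition N (m n : nat) : nat := 'C(m + n, m).

Lemma card_monomials m n : #|{: 'X_{1..m < n.+1}}| = N m n.
Proof.
rewrite /N -card_partial_ord_partitions.
have tupP (x : 'X_{1..m < n.+1}) i : (x i < n.+1)%N.
  by rewrite (leq_ltn_trans _ (bmdeg x)) // mdegE (bigD1 i) //= leq_addr.
pose g (x : 'X_{1..m < n.+1}) : m.-tuple 'I_n.+1 :=
  [tuple Ordinal (tupP x i) | i < m].
have g_inj : injective g.
  move=> x y /(congr1 (fun t => tnth t)) eq_g; apply/val_inj/mnmP => i /=.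
  by have /(congr1 (fun h => val (h i))) := eq_g; rewrite !tnth_mktuple.
rewrite -cardsT -(card_imset _ g_inj); apply: eq_card => t; rewrite inE.
apply/imsetP/idP => [[x _ ->]|le_t].
  rewrite big_tuple; under eq_bigr do rewrite tnth_mktuple /=.
  by rewrite -mdegE -ltnS bmdeg.
pose y := [multinom (tnth t i : nat) | i < m].
have lt_y : (mdeg y < n.+1)%N.
  rewrite ltnS mdegE; under eq_bigr do rewrite mnmE.
  by rewrite -(big_tuple _ _ _ xpredT (fun i : 'I_n.+1 => i : nat)).
exists (BMultinom lt_y) => //.
by apply: eq_from_tnth => i; apply: val_inj; rewrite tnth_mktuple /= mnmE.
Qed.

(* The fixed order of the monomials of degree at most n is the one in which
   [enum] lists the finite type 'X_{1..m < n.+1}. *)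
Definition monomial (m n : nat) (j : 'I_(N m n)) : 'X_{1..m} :=
  enum_val (cast_ord (esym (card_monomials m n)) j).

Definition Vandermonde_mx (R : realType) (m n : nat) (P : 'I_(N m n) -> 'rV[R]_m)
    : 'M[R]_(N m n) :=
  \matrix_(i, j) \prod_(k < m) P i 0 k ^+ monomial j k.

Definition generic_nodes (R : realType) (m n : nat) (P : 'I_(N m n) -> 'rV[R]_m)
    : Prop :=
  Vandermonde_mx P \in unitmx.

Definition interpolates (R : realType) (m n : nat) (f : 'rV[R]_m -> R)
    (P : 'I_(N m n) -> 'rV[R]_m) (Q : {mpoly R[m]}) : Prop :=
  (msize Q <= n.+1)%N /\ forall i, Q.@[P i 0] = f (P i).

(* A real RAM with an oracle for f.  It has an array of integer cells, used for
   indices, counters and exponents, and an array of real cells.  Both are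
   accessible by computed addresses.  The sizes of the arrays are fixed during
   a run, the program cannot observe them, and a run that leaves them, or that
   divides by 0, gets stuck: its expressions evaluate to [None].  There is no
   conversion between integers and reals, and the only real literals are 0
   and 1. *)
Record state (R : realType) := State { icells : seq nat; rcells : seq R }.

Definition storage (R : realType) (s : state R) : nat :=
  size (icells s) + size (rcells s).

Inductive iexp : Type :=
  | IConst of nat
  | IGet of iexp
  | IAdd of iexp & iexp
  | ISub of iexp & iexp (* truncated subtraction *)
  | IMul of iexp & iexp.

Inductive rexp : Type :=
  | RZero
  | ROne
  | RGet of iexp
  | RAdd of rexp & rexp
  | RSub of rexp & rexp
  | RMul of rexp & rexp
  | RDiv of rexp & rexp.

Inductive test : Type :=
  | ILe of iexp & iexp
  | RLe of rexp & rexp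
  | Not of test.

(* [ISet a e] and [RSet a e] write the value of e at address a; [Query a b]
   writes at address a the value of f at the vector stored in the m real cells
   that start at address b. *)
Inductive cmd : Type :=
  | Skip
  | Seq of cmd & cmd
  | ISet of iexp & iexp
  | RSet of iexp & rexp
  | Query of iexp & iexp
  | If of test & cmd & cmd
  | While of test & cmd.

Definition obind2 (A B C : Type) (op : A -> B -> option C)
    (x : option A) (y : option B) : option C :=
  if x is Some u then if y is Some v then op u v else None else None.

Fixpoint ieval (R : realType) (s : state R) (e : iexp) : option nat :=
  match e with
  | IConst k => Some k
  | IGet a => obind (onth (icells s)) (ieval s a)
  | IAdd e1 e2 => obind2 (fun u v => Some (u + v)%N) (ieval s e1) (ieval s e2)
  | ISub e1 e2 => obind2 (fun u v => Some (u - v)%N) (ieval s e1) (ieval s e2)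
  | IMul e1 e2 => obind2 (fun u v => Some (u * v)%N) (ieval s e1) (ieval s e2)
  end.

Fixpoint reval (R : realType) (s : state R) (e : rexp) : option R :=
  match e with
  | RZero => Some 0
  | ROne => Some 1
  | RGet a => obind (onth (rcells s)) (ieval s a)
  | RAdd e1 e2 => obind2 (fun u v => Some (u + v)) (reval s e1) (reval s e2)
  | RSub e1 e2 => obind2 (fun u v => Some (u - v)) (reval s e1) (reval s e2)
  | RMul e1 e2 => obind2 (fun u v => Some (u * v)) (reval s e1) (reval s e2)
  | RDiv e1 e2 => obind2 (fun u v => if v == 0 then None else Some (u / v))
                    (reval s e1) (reval s e2)
  end.

Fixpoint teval (R : realType) (s : state R) (b : test) : option bool :=
  match b with
  | ILe e1 e2 => obind2 (fun u v => Some (u <= v)%N) (ieval s e1) (ieval s e2)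
  | RLe e1 e2 => obind2 (fun u v => Some (u <= v)) (reval s e1) (reval s e2)
  | Not b => omap negb (teval s b)
  end.

(* Every literal, memory access, operation and comparison costs 1, and so does
   every execution of a command, oracle calls included. *)
Fixpoint icost (e : iexp) : nat :=
  match e with
  | IConst _ => 1
  | IGet a => (icost a).+1
  | IAdd e1 e2 | ISub e1 e2 | IMul e1 e2 => (icost e1 + icost e2).+1
  end.

Fixpoint rcost (e : rexp) : nat :=
  match e with
  | RZero | ROne => 1
  | RGet a => (icost a).+1
  | RAdd e1 e2 | RSub e1 e2 | RMul e1 e2 | RDiv e1 e2 =>
      (rcost e1 + rcost e2).+1
  end.

Fixpoint tcost (b : test) : nat :=
  match b with
  | ILe e1 e2 => (icost e1 + icost e2).+1
  | RLe e1 e2 => (rcost e1 + rcost e2).+1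
  | Not b => (tcost b).+1
  end.

Definition iwrite (R : realType) (s : state R) (a v : nat) : state R :=
  State (set_nth 0%N (icells s) a v) (rcells s).

Definition rwrite (R : realType) (s : state R) (a : nat) (v : R) : state R :=
  State (icells s) (set_nth 0 (rcells s) a v).

(* [exec f c s t s']: started in state s, with oracle f, the command c
   terminates in state s' after time t. *)
Inductive exec (R : realType) (m : nat) (f : 'rV[R]_m -> R) :
    cmd -> state R -> nat -> state R -> Prop :=
  | ExecSkip s : exec f Skip s 1 s
  | ExecSeq c1 c2 s s1 s2 t1 t2 :
      exec f c1 s t1 s1 -> exec f c2 s1 t2 s2 ->
      exec f (Seq c1 c2) s (t1 + t2).+1 s2
  | ExecISet a e s i v :
      ieval s a = Some i -> (i < size (icells s))%N -> ieval s e = Some v ->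
      exec f (ISet a e) s (icost a + icost e).+1 (iwrite s i v)
  | ExecRSet a e s i v :
      ieval s a = Some i -> (i < size (rcells s))%N -> reval s e = Some v ->
      exec f (RSet a e) s (icost a + rcost e).+1 (rwrite s i v)
  | ExecQuery a b s i j (x : 'rV[R]_m) :
      ieval s a = Some i -> (i < size (rcells s))%N -> ieval s b = Some j ->
      (forall k : 'I_m, onth (rcells s) (j + k) = Some (x 0 k)) ->
      exec f (Query a b) s (icost a + icost b).+1 (rwrite s i (f x))
  | ExecIfTrue b c1 c2 s t s' :
      teval s b = Some true -> exec f c1 s t s' ->
      exec f (If b c1 c2) s (tcost b + t).+1 s'
  | ExecIfFalse b c1 c2 s t s' :
      teval s b = Some false -> exec f c2 s t s' ->
      exec f (If b c1 c2) s (tcost b + t).+1 s'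
  | ExecWhileFalse b c s :
      teval s b = Some false -> exec f (While b c) s (tcost b).+1 s
  | ExecWhileTrue b c s t1 s1 t2 s2 :
      teval s b = Some true -> exec f c s t1 s1 ->
      exec f (While b c) s1 t2 s2 ->
      exec f (While b c) s (tcost b + t1 + t2).+1 s2.

Lemma exec_det (R : realType) (m : nat) (f : 'rV[R]_m -> R) c s t1 s1 t2 s2 :
  exec f c s t1 s1 -> exec f c s t2 s2 -> t1 = t2 /\ s1 = s2.
Proof.
move=> ex1; elim: ex1 t2 s2 => {c s t1 s1}.
- by move=> s t s2 ex2; inversion ex2.
- move=> c1 c2 s s1 s2 t1 t2 _ IH1 _ IH2 t s' ex2.
  inversion ex2 as [|? ? ? ? ? ? ? e1 e2| | | | | | |]; subst.
  by have [? ?] := IH1 _ _ e1; subst; have [-> ->] := IH2 _ _ e2.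
- by move=> a e s i v Ha _ He t s2 ex2; inversion ex2; split; congruence.
- by move=> a e s i v Ha _ He t s2 ex2; inversion ex2; split; congruence.
- move=> a b s i j x Ha _ Hb Hx t s2 ex2.
  inversion ex2 as [| | | |? ? ? i' j' x' Ha' _ Hb' Hx'| | | |]; subst.
  have -> : i' = i by congruence.
  have ej : j' = j by congruence.
  suff -> : x' = x by [].
  by apply/rowP => k; have := Hx k; rewrite -ej Hx' => -[].
- move=> b c1 c2 s t s1 Hb _ IH t2 s2 ex2.
  inversion ex2 as [| | | | |? ? ? ? ? ? ? e1| | |]; subst; last congruence.
  by have [-> ->] := IH _ _ e1.
- move=> b c1 c2 s t s1 Hb _ IH t2 s2 ex2.
  inversion ex2 as [| | | | | |? ? ? ? ? ? ? e1| |]; subst; first congruence.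
  by have [-> ->] := IH _ _ e1.
- by move=> b c s Hb t s2 ex2; inversion ex2; subst; [|congruence].
- move=> b c s t1 s1 t2 s2 Hb _ IH1 _ IH2 t s' ex2.
  inversion ex2 as [| | | | | | | |? ? ? ? ? ? ? ? e1 e2]; subst.
    congruence.
  by have [? ?] := IH1 _ _ e1; subst; have [-> ->] := IH2 _ _ e2.
Qed.

(* Input: m and n in the integer cells 0 and 1, mu in the real cells
   0, ..., m - 1.  The other cells, wi integer and wr real ones, hold 0. *)
Definition init (R : realType) (m n : nat) (mu : 'rV[R]_m) (wi wr : nat)
    : state R :=
  State ([:: m; n] ++ nseq wi 0%N) ([seq mu 0 k | k <- enum 'I_m] ++ nseq wr 0).

(* Output: the integer cells 0, 1, 2 hold the addresses of the array of nodes
   (row by row), of the array of coefficients, and of the array of exponents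
   (row by row) that tells to which monomial each coefficient belongs. *)
Definition outputs_nodes (R : realType) (m n : nat) (s : state R)
    (P : 'I_(N m n) -> 'rV[R]_m) : Prop :=
  exists2 a : nat, onth (icells s) 0 = Some a &
    forall (i : 'I_(N m n)) (k : 'I_m),
      onth (rcells s) (a + i * m + k) = Some (P i 0 k).

Definition outputs_poly (R : realType) (m n : nat) (s : state R)
    (Q : {mpoly R[m]}) : Prop :=
  exists (b e : nat) (mon : 'I_(N m n) -> 'X_{1..m < n.+1}),
    [/\ onth (icells s) 1 = Some b,
        onth (icells s) 2 = Some e,
        bijective mon,
        forall (j : 'I_(N m n)) (k : 'I_m),
          onth (icells s) (e + j * m + k) = Some (mon j k) &
        forall j : 'I_(N m n), onth (rcells s) (b + j) = Some Q@_(mon j)].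

(* Main.v *)
Require Import Defs.
From mathcomp Require Import all_boot all_order all_algebra.
From mathcomp Require Import reals.
From mathcomp Require Import mpoly.
From mathcomp Require Import zify ring.

(* The nodes are the exponent vectors a of degree at most n, read as points of
   R^m and listed in graded lexicographic order.  On the grid translated by mu,
   the Newton basis N_a(x) = prod_k prod_(t < a_k) (x_k - mu_k - t) is
   triangular: N_a vanishes at the node b unless a <= b componentwise.  So the
   coefficients in this basis come from forward substitution, where the row of
   all N_a(b) for fixed b takes linear time, because N_a is N_(a - e_k) times a
   linear factor.  The Newton basis is then turned into the monomial basis in
   place: for each axis k, for l = n - 1, ..., 0 and for increasing a with
   a_k > l, subtract (mu_k + l) c_a from c_(a - e_k); every single step
   preserves the interpolant, since it replaces one basis element.  As adding
   e_k preserves the order, a - e_k is found by counting the monomials before a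
   that are divisible by x_k.  The conversion takes m n N(m, n) steps, and
   m n < N(m, n).  If n = 0, one query has to suffice, as N(m, n)^2 = 1 does not
   even leave the time for a loop over the coordinates.

   Since the algorithm finds an interpolant of every f, the Vandermonde matrix
   is surjective, hence regular. *)

Set Implicit Arguments.
Unset Strict Implicit.
Unset Printing Implicit Defensive.

Import Order.TTheory GRing.Theory Num.Theory.
Local Open Scope ring_scope.

(** * Successors in the graded lexicographic order *)

Section Successor.

Local Open Scope nat_scope.
Variable m : nat.
Implicit Types (a b c : 'X_{1..m}) (k t : 'I_m).

Lemma mnm_le_mdeg_eq a c : (forall t, a t <= c t) -> mdeg c <= mdeg a -> a = c.
Proof.
move=> /mnm_lepP le_ac le_deg; rewrite -(submK le_ac).
suff /eqP -> : (c - a)%MM == 0%MM by rewrite add0m.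
by rewrite -mdeg_eq0; have := mdegD (c - a)%MM a; rewrite submK //; lia.
Qed.

(** With [k] the last index of the support, one unit moves from x_k to x_(k-1) and the rest of x_k
    goes to the last variable; for [k = 0] the result is the power of the last variable of the next
    degree. The index [m.-1] is tested first because it may equal [k]. *)
Definition mnm_succ a k : 'X_{1..m} :=
  [multinom if t == m.-1 :> nat then (if 0 < k then a k - 1 else (a k).+1)
            else if (0 < k) && (t.+1 == k) then (a t).+1
            else if t == k then 0 else a t | t < m].

(** Index 0 also serves for the zero exponent vector, which is why positivity is asked only for
    [0 < k]. *)
Definition last_support a k :=
  (forall t, k < t -> a t = 0) /\ (0 < k -> 0 < a k).

Lemma mdeg_mnm_succ a k :
  last_support a k -> mdeg (mnm_succ a k) = mdeg a + (k == 0 :> nat).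
Proof.
move=> [a0 ak].
have lt_last : m.-1 < m by rewrite prednK ?(leq_ltn_trans _ (ltn_ord k)).
pose l := Ordinal lt_last.
have [k0|k_gt0] := posnP k.
  have aE : a = (U_(k) *+ a k)%MM.
    apply/mnmP => t; rewrite mulmnE mnm1E; have [->|ne] := eqVneq k t.
      by rewrite mul1n.
    by rewrite a0 //; move: ne; rewrite -val_eqE /=; lia.
  have -> : mnm_succ a k = (U_(l) *+ (a k).+1)%MM.
    apply/mnmP => t; rewrite mnmE mulmnE mnm1E -!val_eqE /= k0 /= [m.-1 == _]eq_sym.
    case: eqP => _; first by rewrite mul1n.
    by case: eqP => // ne_t0; rewrite a0 // k0; lia.
  by rewrite [in RHS]aE !mdegMn !mdeg1; lia.
have lt_pred : k.-1 < m by rewrite (leq_ltn_trans (leq_pred k)).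
pose p := Ordinal lt_pred.
pose r := [multinom if t < k then a t else 0 | t < m].
have aE : a = (r + U_(k) *+ a k)%MM.
  apply/mnmP => t; rewrite mnmDE mulmnE mnm1E mnmE -val_eqE /=.
  case: (ltngtP t k) => [lt_tk|lt_kt|/val_inj ->]; [|by rewrite a0 //; lia|]; lia.
have -> : mnm_succ a k = (r + U_(p) + U_(l) *+ (a k - 1))%MM.
  apply/mnmP => t; rewrite !mnmDE mulmnE !mnm1E !mnmE -!val_eqE /= k_gt0 /=.
  have := ltn_ord t; have := ltn_ord k; case: (ltngtP t k) => [|/a0|/val_inj ->];
    by do !case: eqP => /=; lia.
by rewrite [in RHS]aE !mdegD !mdegMn !mdeg1; have := ak k_gt0; lia.
Qed.

(** Anything strictly between [a] and its successor [b] has the degree of one of them, and can first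
    differ from that one only before [k]. For [k = 0] no such index exists. For [0 < k] the degrees
    of [a] and [b] agree, and before [k] they differ by a single unit, at the last index, which
    leaves no room. *)
Lemma mnm_succ_cover a k : last_support a k ->
  (a < mnm_succ a k)%O /\ forall c, (a < c)%O -> (mnm_succ a k <= c)%O.
Proof.
move=> ls; have deg_b := mdeg_mnm_succ ls; case: ls => a0 ak.
set b := mnm_succ a k in deg_b *.
have bE t : b t = if t == m.-1 :> nat then (if 0 < k then a k - 1 else (a k).+1)
            else if (0 < k) && (t.+1 == k) then (a t).+1
            else if t == k then 0 else a t by rewrite /b mnmE.
clearbody b.
(* From [k] on, [b] vanishes except possibly at the last index, so a first difference [c i < b i]
   with [k <= i] could only sit there; then [c <= b] componentwise, against equal degrees. *)
have last_lt c : (c < b)%O -> mdeg c = mdeg b ->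
    exists2 i : 'I_m, (forall j : 'I_m, j < i -> c j = b j) & c i < b i /\ i < k.
  move=> lt_cb deg_cb; have [i pre lt_i] := ltmcP deg_cb lt_cb; exists i => //.
  split=> //; rewrite ltnNge; apply/negP => le_ki.
  suff eq_cb : c = b by move: lt_cb; rewrite eq_cb ltxx.
  apply: mnm_le_mdeg_eq; last by rewrite deg_cb.
  move=> t; case: (ltngtP t i) => [/pre -> //|lt_it|/val_inj ->]; last exact: ltnW.
  move: lt_i; rewrite bE.
  have -> : (i == m.-1 :> nat) = false by have := ltn_ord t; lia.
  have -> : (i.+1 == k) = false by lia.
  rewrite andbF; case: eqVneq => // ne_ik.
  by rewrite a0 // ltn_neqAle le_ki andbT eq_sym.
split.
  have [k0|k_gt0] := posnP k; first by apply: lt_mdeg_ltmc; rewrite deg_b k0; lia.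
  have deg_ab : mdeg a = mdeg b by rewrite deg_b; lia.
  have lt_pred : k.-1 < m by rewrite (leq_ltn_trans (leq_pred k)).
  apply/(ltmcP deg_ab); exists (Ordinal lt_pred) => /= [j|].
    by have := ltn_ord k; rewrite bE k_gt0 -val_eqE /=; do !case: eqP; lia.
  by have := ltn_ord k; rewrite bE k_gt0 -val_eqE /=; do !case: eqP; lia.
move=> c lt_ac; rewrite leNgt; apply/negP => lt_cb.
have le_ac : mdeg a <= mdeg c by apply/lemc_mdeg/ltW.
have le_cb : mdeg c <= mdeg b by apply/lemc_mdeg/ltW.
(* As [a] vanishes after [k], a first difference at or after [k] would give [a <= c]
   componentwise. *)
have deg_ca : mdeg a = mdeg c ->
    exists2 i : 'I_m, (forall j : 'I_m, j < i -> a j = c j) & a i < c i /\ i < k.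
  move=> deg_ac; have [i pre lt_i] := ltmcP deg_ac lt_ac; exists i => //.
  split=> //; rewrite ltnNge; apply/negP => le_ki.
  suff eq_ac : a = c by move: lt_ac; rewrite eq_ac ltxx.
  apply: mnm_le_mdeg_eq; last by rewrite deg_ac.
  move=> t; case: (ltngtP t i) => [/pre -> //|lt_it|/val_inj ->]; last exact: ltnW.
  by rewrite a0 // (leq_ltn_trans le_ki).
have [k0|k_gt0] := posnP k.
  have [eq_ac|ne_ac] := eqVneq (mdeg a) (mdeg c).
    by have [i _ [_]] := deg_ca eq_ac; rewrite k0.
  have [|i _ [_]] := last_lt _ lt_cb; first lia.
  by rewrite k0.
have [|i pre [lt_i lt_ik]] := last_lt _ lt_cb; first lia.
have [|j pre' [lt_j lt_jk]] := deg_ca; first lia.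
have bE' t : t < k -> b t = if t.+1 == k then (a t).+1 else a t.
  move=> lt_tk; rewrite bE k_gt0 /= -val_eqE /=.
  have -> : (t == m.-1 :> nat) = false by have := ltn_ord k; lia.
  by case: eqP => // _; case: eqP => //; lia.
case: (ltngtP i j) => [lt_ij|lt_ji|/val_inj eq_ij].
- by move: lt_i; rewrite -pre' // bE' //; case: eqP; lia.
- by move: lt_j; rewrite pre // bE' //; case: eqP; lia.
- by move: lt_i lt_j; rewrite eq_ij bE' //; case: eqP; lia.
Qed.

End Successor.

(** * The increasing list of the monomials of degree at most n *)

Section Enumeration.

Local Open Scope nat_scope.
Variables m n : nat.

(** The program lists the monomials in increasing order, which need not be the order of [monomial];
    the two are related only through the interpolants. *)
Definition mons : seq 'X_{1..m} :=
  sort <=%O [seq val a | a <- enum {: 'X_{1..m < n.+1}}].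

(** The default 0 makes the degree bound hold for every index. *)
Definition mon_nth i : 'X_{1..m} := nth 0%MM mons i.

Lemma size_mons : size mons = N m n.
Proof. by rewrite size_sort size_map -cardE card_monomials. Qed.

Lemma mem_mons a : (a \in mons) = (mdeg a <= n).
Proof.
rewrite mem_sort; apply/mapP/idP => [[b _ ->]|le_an]; first by rewrite -ltnS bmdeg.
by exists (BMultinom (n := m) (bound := n.+1) (bmnm := a) le_an); rewrite ?mem_enum.
Qed.

Lemma mons_sorted : sorted <%O mons.
Proof. by rewrite sort_lt_sorted map_inj_uniq ?enum_uniq //; apply: val_inj. Qed.

Lemma mdeg_mon_nth i : mdeg (mon_nth i) <= n.
Proof.
have [lt_i|le_i] := ltnP i (size mons); first by rewrite -mem_mons mem_nth.
by rewrite /mon_nth nth_default // mdeg0.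
Qed.

Lemma ltn_mon_nth i j : i < N m n -> j < N m n ->
  (mon_nth i < mon_nth j)%O = (i < j).
Proof. by rewrite -size_mons => *; rewrite lt_sorted_ltn_nth ?mons_sorted. Qed.

Lemma mon_nth_inj i j : i < N m n -> j < N m n -> mon_nth i = mon_nth j -> i = j.
Proof.
by move=> lt_i lt_j eq_ij; have := ltn_mon_nth lt_i lt_j;
   have := ltn_mon_nth lt_j lt_i; rewrite eq_ij ltxx; lia.
Qed.

Lemma mon_nthP a : mdeg a <= n -> exists2 i, i < N m n & mon_nth i = a.
Proof. by rewrite -mem_mons -size_mons => /(nthP 0%MM). Qed.

Lemma N_gt0 : 0 < N m n.
Proof. by rewrite bin_gt0 leq_addr. Qed.

Lemma mon_nth0 : mon_nth 0 = 0%MM.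
Proof.
have [|i lt_i def_i] := @mon_nthP 0%MM; first by rewrite mdeg0.
case: i lt_i def_i => // i lt_i def_i.
have := ltn_mon_nth N_gt0 lt_i.
by rewrite def_i ltNge le0x.
Qed.

Lemma mon_nth_succ i k : i < N m n -> last_support (mon_nth i) k ->
  mdeg (mnm_succ (mon_nth i) k) <= n ->
  i.+1 < N m n /\ mon_nth i.+1 = mnm_succ (mon_nth i) k.
Proof.
move=> lt_i ls le_n; have [lt_b cov] := mnm_succ_cover ls.
have [j lt_j def_b] := mon_nthP le_n; rewrite -def_b in lt_b cov *.
have lt_ij : i < j by rewrite -ltn_mon_nth.
have lt_i1 : i.+1 < N m n by apply: leq_ltn_trans lt_j.
split=> //; congr mon_nth; apply/eqP; rewrite eqn_leq lt_ij leqNgt.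
by rewrite -ltn_mon_nth // -leNgt cov // ltn_mon_nth.
Qed.

(** If x_k divides the i-th monomial, this is the index of the quotient; being a count, it can be
    maintained by one counter. *)
Definition pred_rank k i := count (fun a : 'X_{1..m} => 0 < nth 0 a k) (take i mons).

Lemma pred_rank0 k : pred_rank k 0 = 0.
Proof. by rewrite /pred_rank take0. Qed.

Lemma mnm_nth (a : 'X_{1..m}) (k : 'I_m) : nth 0 a k = a k.
Proof. by rewrite mnm_tnth (tnth_nth 0). Qed.

(* Adding [U_(k)] preserves the monomial order, so it maps the monomials of
   degree less than n, which come first, increasingly onto those divisible by
   [U_(k)]. *)
Lemma mon_nth_pred_rank (k : 'I_m) i : i < N m n -> 0 < mon_nth i k ->
  pred_rank k i < i /\ mon_nth i = (mon_nth (pred_rank k i) + U_(k))%MM.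
Proof.
move=> lt_i gt0; pose D := [seq a : 'X_{1..m} <- mons | 0 < nth 0 a k].
pose L := [seq a <- mons | mdeg a < n].
have eqD : D = [seq (a + U_(k))%MM | a <- L].
  apply: lt_sorted_eq.
  - by apply: lt_sorted_filter; apply: mons_sorted.
  - apply: homo_sorted (lt_sorted_filter _ mons_sorted) => a b lt_ab.
    by rewrite ltmc_add2l.
  - move=> a; rewrite mem_filter mem_mons; apply/andP/mapP => [[a_gt0 le_an]|[b]].
    have le_ka : (U_(k) <= a)%MM.
      by apply/mnm_lepP => t; rewrite mnm1E; case: eqP => // <-; rewrite -mnm_nth.
    exists (a - U_(k))%MM; last by rewrite submK.
    have := mdegD (a - U_(k))%MM U_(k); rewrite submK // mdeg1 => eq_deg.
    by rewrite mem_filter mem_mons; lia.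
  rewrite mem_filter mem_mons => /andP[lt_bn _] ->.
  by rewrite mnm_nth mnmDE mnm1E eqxx mdegD mdeg1; lia.
have nthD : nth 0%MM D (pred_rank k i) = mon_nth i.
  move: lt_i; rewrite -size_mons => lt_i.
  rewrite /D -[X in filter _ X](cat_take_drop i) filter_cat nth_cat size_filter.
  by rewrite ltnn subnn (drop_nth 0%MM) //= mnm_nth gt0.
have lt_rD : pred_rank k i < size D.
  move: lt_i; rewrite -size_mons => lt_i.
  rewrite /D -[X in filter _ X](cat_take_drop i) filter_cat size_cat size_filter.
  by rewrite -/(pred_rank k i) (drop_nth 0%MM) //= mnm_nth gt0 /=; lia.
have eqL : mons = L ++ [seq a <- mons | ~~ (mdeg a < n)].
  apply: lt_sorted_eq; first exact: mons_sorted.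
    rewrite lt_sorted_pairwise pairwise_cat -!lt_sorted_pairwise.
    rewrite !lt_sorted_filter ?mons_sorted // !andbT.
    apply/allrelP => a b; rewrite !mem_filter -leqNgt => /andP[lt_an _] /andP[le_nb _].
    by apply: lt_mdeg_ltmc; apply: leq_trans le_nb.
  by move=> a; rewrite mem_cat !mem_filter; case: (mdeg a < n); rewrite //= orbF.
have eqa : mon_nth i = (mon_nth (pred_rank k i) + U_(k))%MM.
  rewrite eqD size_map in lt_rD; rewrite -nthD eqD (nth_map 0%MM) //.
  by congr (_ + _)%MM; rewrite /mon_nth eqL nth_cat lt_rD.
split=> //; have lt_rN : pred_rank k i < N m n.
  by apply: leq_trans lt_rD _; rewrite -size_mons size_filter count_size.
rewrite -ltn_mon_nth // eqa -{1}[mon_nth (pred_rank k i)]addm0 ltmc_add2r.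
by apply: lt_mdeg_ltmc; rewrite mdeg0 mdeg1.
Qed.

Definition expo i k : nat := nth 0 (mon_nth i) k.

Lemma expoE i (k : 'I_m) : expo i k = mon_nth i k.
Proof. exact: mnm_nth. Qed.

Lemma expo_le i k : k < m -> expo i k <= n.
Proof.
move=> lt_k; rewrite (expoE i (Ordinal lt_k)) (leq_trans _ (mdeg_mon_nth i)) //.
by rewrite mdegE (bigD1 (Ordinal lt_k)) //= leq_addr.
Qed.

Lemma expo0 k : expo 0 k = 0.
Proof.
have [lt_k|le_k] := ltnP k m; last by rewrite /expo nth_default ?size_tuple.
by rewrite (expoE 0 (Ordinal lt_k)) mon_nth0 mnm0E.
Qed.

Lemma expo_inj i j : i < N m n -> j < N m n ->
  (forall k, k < m -> expo i k = expo j k) -> i = j.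
Proof.
move=> lt_i lt_j eq_ij; apply: mon_nth_inj => //; apply/mnmP => k.
by rewrite -!expoE eq_ij.
Qed.

(** The monomial order refines divisibility; this makes the Newton system triangular. *)
Lemma expo_le_leq i j : i < N m n -> j < N m n ->
  (forall k, k < m -> expo i k <= expo j k) -> i <= j.
Proof.
move=> lt_i lt_j le_ij; rewrite leqNgt -ltn_mon_nth // -leNgt.
have le_ij' : (mon_nth i <= mon_nth j)%MM.
  by apply/mnm_lepP => k; rewrite -!expoE le_ij.
by rewrite -(submK le_ij') lemc_addl.
Qed.

(** Guarantees that every monomial but the first has some [a - e_k] from which its Newton value can
    be computed. *)
Lemma expo_neq0 i : 0 < i < N m n -> exists2 k, k < m & 0 < expo i k.
Proof.
move=> /andP[i_gt0 lt_i].
have [[k gt0]|all0] := pickP (fun k : 'I_m => 0 < expo i k); first by exists k.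
have i0 : i = 0; last by rewrite i0 in i_gt0.
apply: expo_inj; rewrite ?N_gt0 // => k lt_k.
by rewrite expo0; have /= := all0 (Ordinal lt_k); lia.
Qed.

Lemma pred_rankS k i : i < N m n -> pred_rank k i.+1 = pred_rank k i + (0 < expo i k).
Proof.
rewrite -size_mons => lt_i.
by rewrite /pred_rank (take_nth 0%MM lt_i) -cats1 count_cat /= addn0.
Qed.

Lemma expo_pred_rank k i : k < m -> i < N m n -> 0 < expo i k ->
  pred_rank k i < i /\ forall t, t < m -> expo i t = expo (pred_rank k i) t + (t == k).
Proof.
move=> lt_k lt_i; rewrite (expoE i (Ordinal lt_k)) => gt0.
have [lt_r def_i] := mon_nth_pred_rank lt_i gt0; split=> // t lt_t.
rewrite (expoE i (Ordinal lt_t)) (expoE _ (Ordinal lt_t)) def_i mnmDE mnm1E.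
by rewrite -val_eqE /= (eq_sym k).
Qed.

(** The degree grows only for [k = 0]; then the whole degree sits in x_0, so [expo i 0 < n] keeps
    the successor in the list. *)
Lemma expo_succ i k : i < N m n -> k < m -> expo i 0 < n ->
  (forall t, t < m -> k < t -> expo i t = 0) -> (0 < k -> 0 < expo i k) ->
  i.+1 < N m n /\ forall t, t < m -> expo i.+1 t =
    if t == m.-1 then (if 0 < k then expo i k - 1 else (expo i k).+1)
    else if (0 < k) && (t.+1 == k) then (expo i t).+1
    else if t == k then 0 else expo i t.
Proof.
move=> lt_i lt_k lt_n ex_k0 ex_k; pose k' := Ordinal lt_k.
have ls : last_support (mon_nth i) k'.
  by split=> [t lt_t|gt0]; rewrite -expoE; [apply: ex_k0|apply: ex_k].
have le_n : mdeg (mnm_succ (mon_nth i) k') <= n.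
  rewrite mdeg_mnm_succ // /=; have := mdeg_mon_nth i.
  case: posnP => [k0 _|]; last by rewrite addn0.
  suff -> : mdeg (mon_nth i) = expo i 0 by rewrite addn1.
  rewrite mdegE (bigD1 k') //= big1 ?addn0 => [|t ne_t]; first by rewrite -expoE /= k0.
  by rewrite -expoE ex_k0 //; move: ne_t; rewrite -val_eqE /= k0 lt0n.
have [lt_i1 def_i1] := mon_nth_succ lt_i ls le_n; split=> // t lt_t.
by rewrite (expoE _ (Ordinal lt_t)) def_i1 mnmE -!expoE -val_eqE.
Qed.

(** The greatest monomial is x_0^n, since its successor has degree n + 1. It is the only one in the
    list with exponent n at x_0, so the first exponent alone tells where the list ends. *)
Lemma expo_last : 0 < m ->
  expo (N m n).-1 0 = n /\ forall i, i.+1 < N m n -> expo i 0 < n.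
Proof.
move=> m_gt0; pose z := Ordinal m_gt0; have N_n0 := N_gt0.
have ls : last_support (U_(z) *+ n)%MM z.
  split=> // t gt0; rewrite mulmnE mnm1E; case: eqP => // tz.
  by rewrite -tz in gt0.
have [|i0 lt_i0 def_i0] := @mon_nthP (U_(z) *+ n)%MM.
  by rewrite mdegMn mdeg1 mul1n.
have last_i0 : i0.+1 = N m n.
  apply/eqP; rewrite eqn_leq lt_i0 leqNgt; apply/negP => lt_i1.
  have [_ /(_ (mon_nth i0.+1))] := mnm_succ_cover ls.
  rewrite -def_i0 ltn_mon_nth // ltnSn => /(_ isT)/lemc_mdeg.
  rewrite def_i0 mdeg_mnm_succ // mdegMn mdeg1; have := mdeg_mon_nth i0.+1.
  by rewrite /=; lia.
split=> [|i lt_i1].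
  by rewrite -last_i0 (expoE _ z) def_i0 mulmnE mnm1E eqxx mul1n.
rewrite ltn_neqAle expo_le // andbT; apply/eqP => eq_n.
suff eq_i : i0 = i by rewrite -last_i0 eq_i ltnn in lt_i1.
apply: mon_nth_inj; rewrite // ?(ltnW lt_i1) // def_i0.
apply: mnm_le_mdeg_eq; last by rewrite mdegMn mdeg1 mul1n mdeg_mon_nth.
move=> t; rewrite mulmnE mnm1E -expoE; case: eqP => // <-.
by rewrite mul1n /= eq_n.
Qed.

End Enumeration.

(** Double induction with the rule of Pascal. It absorbs the cost of the change of basis into the
    square of [N m n]. *)
Lemma leq_muln_N m n : (0 < m -> m * n < N m n)%N.
Proof.
case: m => // m _; elim: m n => [|m IHm] n.
  by rewrite /N bin1 mul1n.
elim: n => [|n IHn]; first by rewrite muln0 N_gt0.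
have -> : N m.+2 n.+1 = (N m.+2 n + N m.+1 n.+1)%N.
  by rewrite /N addnS binS; congr (_ + 'C(_, _))%N; rewrite addSn addnS.
by move: (IHm n.+1) IHn; rewrite -/(N _ _); lia.
Qed.

(** * Reading and writing concatenated arrays *)

Section SeqAccess.
Variables (A : Type) (x0 : A).
Implicit Types s : seq A.

Lemma onth_cat_shift s1 s2 i : onth (s1 ++ s2) (size s1 + i) = onth s2 i.
Proof. by rewrite onth_cat ltnNge leq_addr /= addKn. Qed.

Lemma onth_catl s1 s2 i : (i < size s1)%N -> onth (s1 ++ s2) i = onth s1 i.
Proof. by rewrite onth_cat => ->. Qed.

Lemma onth_mkseq (g : nat -> A) k i : (i < k)%N -> onth (mkseq g k) i = Some (g i).
Proof.
by move=> lt_i; rewrite onthE (nth_map (g 0%N)) ?size_mkseq // nth_mkseq.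
Qed.

Lemma set_nth_cat_shift s1 s2 i y :
  set_nth x0 (s1 ++ s2) (size s1 + i) y = s1 ++ set_nth x0 s2 i y.
Proof. by elim: s1 => //= x s1 ->. Qed.

Lemma set_nth_catl s1 s2 i y : (i < size s1)%N ->
  set_nth x0 (s1 ++ s2) i y = set_nth x0 s1 i y ++ s2.
Proof. by elim: s1 i => //= x s1 IH [|i] //= /IH ->. Qed.

(** Array contents are described by functions on the naturals, so a write becomes a pointwise
    update. *)
Definition upd (g : nat -> A) a y := fun i => if i == a then y else g i.

Definition upd2 (g : nat -> nat -> A) a b y :=
  fun i k => if (i == a) && (k == b) then y else g i k.

Lemma set_nth_mkseq g k a y : (a < k)%N ->
  set_nth x0 (mkseq g k) a y = mkseq (upd g a y) k.
Proof.
move=> lt_a; apply: (@eq_from_nth _ x0).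
  by rewrite size_set_nth !size_mkseq; apply/maxn_idPr.
move=> i; rewrite size_set_nth !size_mkseq (maxn_idPr _) // => lt_i.
by rewrite nth_set_nth /= !nth_mkseq.
Qed.

Lemma onth_mkseq_shift g k s i : onth (mkseq g k ++ s) (k + i) = onth s i.
Proof. by rewrite -{2}(size_mkseq g k) onth_cat_shift. Qed.

Lemma onth_mkseq_cat g k s i : (i < k)%N -> onth (mkseq g k ++ s) i = Some (g i).
Proof. by move=> lt_i; rewrite onth_catl ?size_mkseq // onth_mkseq. Qed.

Lemma set_nth_mkseq_shift g k s i y :
  set_nth x0 (mkseq g k ++ s) (k + i) y = mkseq g k ++ set_nth x0 s i y.
Proof. by rewrite -{2}(size_mkseq g k) set_nth_cat_shift. Qed.

Lemma set_nth_mkseq_cat g k s i y : (i < k)%N ->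
  set_nth x0 (mkseq g k ++ s) i y = mkseq (upd g i y) k ++ s.
Proof. by move=> lt_i; rewrite set_nth_catl ?size_mkseq // set_nth_mkseq. Qed.

Definition table (g : nat -> nat -> A) w h :=
  mkseq (fun t => g (t %/ w)%N (t %% w)%N) (h * w).

Lemma table_bound w h i k : (i < h)%N -> (k < w)%N -> (i * w + k < h * w)%N.
Proof.
move=> lt_i lt_k; rewrite (@leq_trans (i.+1 * w)) ?leq_mul2r ?lt_i ?orbT //.
by rewrite mulSn addnC ltn_add2r.
Qed.

Lemma onth_table g w h i k : (i < h)%N -> (k < w)%N ->
  onth (table g w h) (i * w + k) = Some (g i k).
Proof.
move=> lt_i lt_k; rewrite onth_mkseq ?table_bound //.
have w_gt0 : (0 < w)%N by apply: leq_ltn_trans lt_k.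
by rewrite divnMDl // divn_small // addn0 modnMDl modn_small.
Qed.

Lemma set_nth_table g w h i k y : (i < h)%N -> (k < w)%N ->
  set_nth x0 (table g w h) (i * w + k) y = table (upd2 g i k y) w h.
Proof.
move=> lt_i lt_k; rewrite set_nth_mkseq ?table_bound //.
have w_gt0 : (0 < w)%N by apply: leq_ltn_trans lt_k.
apply: eq_mkseq => t; rewrite /upd /upd2; congr (if _ then _ else _).
apply/eqP/andP => [->|[/eqP <- /eqP <-]]; last exact: divn_eq.
by rewrite divnMDl // divn_small // addn0 modnMDl modn_small.
Qed.

Lemma size_table g w h : size (table g w h) = (h * w)%N.
Proof. exact: size_mkseq. Qed.

Lemma onth_table_shift g w h s i : onth (table g w h ++ s) (h * w + i) = onth s i.
Proof. exact: onth_mkseq_shift. Qed.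

Lemma onth_table_cat g w h s i k : (i < h)%N -> (k < w)%N ->
  onth (table g w h ++ s) (i * w + k) = Some (g i k).
Proof.
by move=> *; rewrite onth_catl ?size_table ?table_bound // onth_table.
Qed.

Lemma set_nth_table_shift g w h s i y :
  set_nth x0 (table g w h ++ s) (h * w + i) y = table g w h ++ set_nth x0 s i y.
Proof. exact: set_nth_mkseq_shift. Qed.

Lemma set_nth_table_cat g w h s i k y : (i < h)%N -> (k < w)%N ->
  set_nth x0 (table g w h ++ s) (i * w + k) y = table (upd2 g i k y) w h ++ s.
Proof.
by move=> *; rewrite set_nth_catl ?size_table ?table_bound // set_nth_table.
Qed.

End SeqAccess.

(** * Total correctness with a time budget *)

Section Run.

Variables (R : realType) (m : nat) (f : 'rV[R]_m -> R).
Implicit Types (c : cmd) (s : state R) (T : nat) (post : state R -> Prop).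

(** As execution is deterministic, one terminating run within the budget speaks about the only
    run. *)
Definition run c s T post :=
  exists t s', [/\ exec f c s t s', (t <= T)%N & post s'].

Lemma run_le c s T T' post : run c s T post -> (T <= T')%N -> run c s T' post.
Proof.
by case=> t [s' [expo le_t ps]] le_T; exists t, s'; split=> //; apply: leq_trans le_T.
Qed.

Lemma run_post c s T post post' :
  run c s T post -> (forall s', post s' -> post' s') -> run c s T post'.
Proof. by case=> t [s' [expo le_t ps]] pp; exists t, s'; split=> //; apply: pp. Qed.

Lemma run_skip s post : post s -> run Skip s 1 post.
Proof. by exists 1%N, s; split=> //; constructor. Qed.

Lemma run_seq c1 c2 s T1 T2 post :
  run c1 s T1 (fun s1 => run c2 s1 T2 post) -> run (Seq c1 c2) s (T1 + T2).+1 post.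
Proof.
case=> t1 [s1 [ex1 le1 [t2 [s2 [ex2 le2 ps]]]]].
by exists (t1 + t2).+1, s2; split=> //; [apply: ExecSeq ex1 ex2|rewrite ltnS leq_add].
Qed.

Lemma run_iset a e s i v post :
  ieval s a = Some i -> (i < size (icells s))%N -> ieval s e = Some v ->
  post (iwrite s i v) -> run (ISet a e) s (icost a + icost e).+1 post.
Proof.
by move=> *; exists (icost a + icost e).+1, (iwrite s i v); split; try constructor.
Qed.

Lemma run_rset a e s i v post :
  ieval s a = Some i -> (i < size (rcells s))%N -> reval s e = Some v ->
  post (rwrite s i v) -> run (RSet a e) s (icost a + rcost e).+1 post.
Proof.
by move=> *; exists (icost a + rcost e).+1, (rwrite s i v); split; try constructor.
Qed.

Lemma run_query a b s i j (x : 'rV[R]_m) post :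
  ieval s a = Some i -> (i < size (rcells s))%N -> ieval s b = Some j ->
  (forall k : 'I_m, onth (rcells s) (j + k) = Some (x 0 k)) ->
  post (rwrite s i (f x)) -> run (Query a b) s (icost a + icost b).+1 post.
Proof.
move=> *; exists (icost a + icost b).+1, (rwrite s i (f x)); split=> //.
by apply: ExecQuery; eassumption.
Qed.

(** Adding the two budgets, instead of taking the maximum, costs at most a constant factor here; a
    branch excluded by [v] may be given any budget, such as 0. *)
Lemma run_if b c1 c2 s v T1 T2 post :
  teval s b = Some v ->
  (v -> run c1 s T1 post) -> (v = false -> run c2 s T2 post) ->
  run (If b c1 c2) s (tcost b + (T1 + T2)).+1 post.
Proof.
case: v => eb r1 r2.
  have [t [s' [expo le_t ps]]] := r1 isT.
  by exists (tcost b + t).+1, s'; split=> //; [apply: ExecIfTrue|lia].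
have [t [s' [expo le_t ps]]] := r2 erefl.
by exists (tcost b + t).+1, s'; split=> //; [apply: ExecIfFalse|lia].
Qed.

(** Induction on the number [d] of remaining iterations; the invariant is indexed by the finished
    ones, and the last summand pays for the failing test. *)
Lemma run_for (inv : nat -> state R -> Prop) b c k T s :
  inv 0%N s ->
  (forall i s1, (i < k)%N -> inv i s1 -> teval s1 b = Some true) ->
  (forall i s1, (i < k)%N -> inv i s1 -> run c s1 T (inv i.+1)) ->
  (forall s1, inv k s1 -> teval s1 b = Some false) ->
  run (While b c) s (k * (tcost b + T).+1 + (tcost b).+1) (inv k).
Proof.
move=> inv0 test_true step test_false.
suff loop : forall d s1, (d <= k)%N -> inv (k - d)%N s1 ->
    run (While b c) s1 (d * (tcost b + T).+1 + (tcost b).+1) (inv k).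
  by apply: loop; rewrite ?subnn.
elim=> [|d IHd] s1 le_d inv1.
  rewrite subn0 in inv1; exists (tcost b).+1, s1; split=> //.
  by apply: ExecWhileFalse; apply: test_false.
have lt_k : (k - d.+1 < k)%N by lia.
have [t1 [s2 [ex1 le1 inv2]]] := step _ _ lt_k inv1.
rewrite subnSK // in inv2.
have [t2 [s3 [ex2 le2 inv3]]] := IHd _ (ltnW le_d) inv2.
exists (tcost b + t1 + t2).+1, s3; split=> //; last by rewrite mulSn; lia.
by apply: ExecWhileTrue ex1 ex2; apply: test_true lt_k inv1.
Qed.

End Run.

(* Memory layout.  Integer cells: 0 and 1 hold m and n, the cells 2, 3, 4 and 6
   are the loop variables i, k, j and l, the cell 5 holds N(m, n) once it is
   known; then come the regions J (m counters), E (the exponents, row by row),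
   P and L (for each monomial a, the index of some a - e_k, and k).  Real cells:
   the input mu, then X (the current point), A (E as real numbers), C (the
   coefficients), T (the values of the Newton basis at the current node).  E and
   A are filled while N(m, n) is unknown, hence they precede P, L, C and T.
   [eJ k], [eE i k], ... are the addresses. *)
Definition cell k := IGet (IConst k).
Definition eJ k := IAdd (IConst 7) k.
Definition eE i k := IAdd (IAdd (IConst 7) (cell 0)) (IAdd (IMul i (cell 0)) k).
Definition eP i := IAdd (IAdd (IAdd (IConst 7) (cell 0)) (IMul (cell 5) (cell 0))) i.
Definition eL i :=
  IAdd (IAdd (IAdd (IAdd (IConst 7) (cell 0)) (IMul (cell 5) (cell 0))) (cell 5)) i.
Definition eX k := IAdd (cell 0) k.
Definition eA i k := IAdd (IAdd (cell 0) (cell 0)) (IAdd (IMul i (cell 0)) k).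
Definition eC i := IAdd (IAdd (IAdd (cell 0) (cell 0)) (IMul (cell 5) (cell 0))) i.
Definition eT i :=
  IAdd (IAdd (IAdd (IAdd (cell 0) (cell 0)) (IMul (cell 5) (cell 0))) (cell 5)) i.

(** * Access to the memory regions *)

Section Memory.

Variables (R : realType) (m n h : nat) (f : 'rV[R]_m -> R) (M : nat -> R).

(** [h] is the number of reserved rows and [q] the content of cell 5. The regions after the tables
    are addressed through [q], whence the hypotheses [q = h] below. *)
Definition mem_state (i k j q l : nat) (J : nat -> nat) (E : nat -> nat -> nat)
    (P L : nat -> nat) (X : nat -> R) (A : nat -> nat -> R) (C T : nat -> R) : state R :=
  State ([:: m; n; i; k; j; q; l] ++
           (mkseq J m ++ (table E m h ++ (mkseq P h ++ mkseq L h))))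
        (mkseq M m ++ (mkseq X m ++ (table A m h ++ (mkseq C h ++ mkseq T h)))).

Section Eval.
Variable s : state R.

Lemma ev_const x : ieval s (IConst x) = Some x.
Proof. by []. Qed.

Lemma ev_add a b x y : ieval s a = Some x -> ieval s b = Some y ->
  ieval s (IAdd a b) = Some (x + y)%N.
Proof. by move=> /= -> ->. Qed.

Lemma ev_sub a b x y : ieval s a = Some x -> ieval s b = Some y ->
  ieval s (ISub a b) = Some (x - y)%N.
Proof. by move=> /= -> ->. Qed.

Lemma rev_add a b x y : reval s a = Some x -> reval s b = Some y ->
  reval s (RAdd a b) = Some (x + y).
Proof. by move=> /= -> ->. Qed.

Lemma rev_sub a b x y : reval s a = Some x -> reval s b = Some y ->
  reval s (RSub a b) = Some (x - y).
Proof. by move=> /= -> ->. Qed.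

Lemma rev_mul a b x y : reval s a = Some x -> reval s b = Some y ->
  reval s (RMul a b) = Some (x * y).
Proof. by move=> /= -> ->. Qed.

Lemma rev_div a b x y : reval s a = Some x -> reval s b = Some y -> y != 0 ->
  reval s (RDiv a b) = Some (x / y).
Proof. by move=> /= -> -> /= /negbTE ->. Qed.

Lemma tev_le a b x y : ieval s a = Some x -> ieval s b = Some y ->
  teval s (ILe a b) = Some (x <= y)%N.
Proof. by move=> /= -> ->. Qed.

End Eval.

Section Regions.

Variables (i k j q l : nat) (J : nat -> nat) (E : nat -> nat -> nat).
Variables (P L : nat -> nat) (X : nat -> R) (A : nat -> nat -> R) (C T : nat -> R).
Notation s := (mem_state i k j q l J E P L X A C T).
Implicit Types (a b : iexp) (x y : nat).

Lemma get_J a x : ieval s a = Some x -> (x < m)%N ->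
  ieval s (IGet (eJ a)) = Some (J x).
Proof.
move=> ea lt_x; rewrite /= ea /= add0n.
by rewrite onth_mkseq_cat.
Qed.

Lemma get_E a b x y : ieval s a = Some x -> ieval s b = Some y ->
  (x < h)%N -> (y < m)%N -> ieval s (IGet (eE a b)) = Some (E x y).
Proof.
move=> ea eb lt_x lt_y; rewrite /= ea eb /= add0n -?addnA.
by rewrite onth_mkseq_shift onth_table_cat.
Qed.

Lemma get_P a x : q = h -> ieval s a = Some x -> (x < h)%N ->
  ieval s (IGet (eP a)) = Some (P x).
Proof.
move=> eq_q ea lt_x; rewrite /= ea /= add0n eq_q -?addnA.
by rewrite onth_mkseq_shift onth_table_shift onth_mkseq_cat.
Qed.

Lemma get_L a x : q = h -> ieval s a = Some x -> (x < h)%N ->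
  ieval s (IGet (eL a)) = Some (L x).
Proof.
move=> eq_q ea lt_x; rewrite /= ea /= add0n eq_q -?addnA.
by rewrite onth_mkseq_shift onth_table_shift onth_mkseq_shift onth_mkseq.
Qed.

Lemma get_M a x : ieval s a = Some x -> (x < m)%N ->
  reval s (RGet a) = Some (M x).
Proof. by move=> ea lt_x; rewrite /= ea /= onth_mkseq_cat. Qed.

Lemma get_X a x : ieval s a = Some x -> (x < m)%N ->
  reval s (RGet (eX a)) = Some (X x).
Proof. by move=> ea lt_x; rewrite /= ea /= onth_mkseq_shift onth_mkseq_cat. Qed.

Lemma get_A a b x y : ieval s a = Some x -> ieval s b = Some y ->
  (x < h)%N -> (y < m)%N -> reval s (RGet (eA a b)) = Some (A x y).
Proof.
move=> ea eb lt_x lt_y; rewrite /= ea eb /= -!addnA.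
by rewrite !onth_mkseq_shift onth_table_cat.
Qed.

Lemma get_C a x : q = h -> ieval s a = Some x -> (x < h)%N ->
  reval s (RGet (eC a)) = Some (C x).
Proof.
move=> eq_q ea lt_x; rewrite /= ea /= eq_q -!addnA.
by rewrite !onth_mkseq_shift onth_mkseq_cat.
Qed.

Lemma get_T a x : q = h -> ieval s a = Some x -> (x < h)%N ->
  reval s (RGet (eT a)) = Some (T x).
Proof.
move=> eq_q ea lt_x; rewrite /= ea /= eq_q -!addnA.
by rewrite !onth_mkseq_shift onth_mkseq.
Qed.

Lemma size_icells : size (icells s) = (7 + (m + (h * m + (h + h))))%N.
Proof. by rewrite /mem_state /= !size_cat size_table !size_mkseq. Qed.

Lemma size_rcells : size (rcells s) = (m + (m + (h * m + (h + h))))%N.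
Proof. by rewrite /mem_state /= !size_cat size_table !size_mkseq. Qed.

Lemma run_i e x post : ieval s e = Some x ->
  post (mem_state x k j q l J E P L X A C T) ->
  run f (ISet (IConst 2) e) s (icost e).+2 post.
Proof. by move=> ev ps; exact: (@run_iset _ _ _ (IConst 2) e s 2 x post erefl isT ev ps). Qed.

Lemma run_k e x post : ieval s e = Some x ->
  post (mem_state i x j q l J E P L X A C T) ->
  run f (ISet (IConst 3) e) s (icost e).+2 post.
Proof. by move=> ev ps; exact: (@run_iset _ _ _ (IConst 3) e s 3 x post erefl isT ev ps). Qed.

Lemma run_j e x post : ieval s e = Some x ->
  post (mem_state i k x q l J E P L X A C T) ->
  run f (ISet (IConst 4) e) s (icost e).+2 post.
Proof. by move=> ev ps; exact: (@run_iset _ _ _ (IConst 4) e s 4 x post erefl isT ev ps). Qed.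

Lemma run_q e x post : ieval s e = Some x ->
  post (mem_state i k j x l J E P L X A C T) ->
  run f (ISet (IConst 5) e) s (icost e).+2 post.
Proof. by move=> ev ps; exact: (@run_iset _ _ _ (IConst 5) e s 5 x post erefl isT ev ps). Qed.

Lemma run_l e x post : ieval s e = Some x ->
  post (mem_state i k j q x J E P L X A C T) ->
  run f (ISet (IConst 6) e) s (icost e).+2 post.
Proof. by move=> ev ps; exact: (@run_iset _ _ _ (IConst 6) e s 6 x post erefl isT ev ps). Qed.

Lemma run_J a e x y post : ieval s a = Some x -> (x < m)%N -> ieval s e = Some y ->
  post (mem_state i k j q l (upd J x y) E P L X A C T) ->
  run f (ISet (eJ a) e) s (icost (eJ a) + icost e).+1 post.
Proof.
move=> ea lt_x ee ps; apply: (@run_iset _ _ _ _ _ _ (7 + x)%N _ _ _ _ ee).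
- by rewrite /= ea.
- by rewrite size_icells; lia.
rewrite /iwrite (set_nth_cat_shift _ [:: m; n; i; k; j; q; l] (_ ++ _)).
by rewrite set_nth_mkseq_cat.
Qed.

Lemma run_E a b e x y z post : ieval s a = Some x -> ieval s b = Some y ->
  (x < h)%N -> (y < m)%N -> ieval s e = Some z ->
  post (mem_state i k j q l J (upd2 E x y z) P L X A C T) ->
  run f (ISet (eE a b) e) s (icost (eE a b) + icost e).+1 post.
Proof.
move=> ea eb lt_x lt_y ee ps.
apply: (@run_iset _ _ _ _ _ _ (7 + (m + (x * m + y)))%N _ _ _ _ ee).
- by rewrite /= ea eb /= !addnA.
- by rewrite size_icells; have := table_bound lt_x lt_y; lia.
rewrite /iwrite (set_nth_cat_shift _ [:: m; n; i; k; j; q; l] (_ ++ _)).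
by rewrite set_nth_mkseq_shift set_nth_table_cat.
Qed.

Lemma run_P a e x y post : q = h -> ieval s a = Some x -> (x < h)%N ->
  ieval s e = Some y -> post (mem_state i k j q l J E (upd P x y) L X A C T) ->
  run f (ISet (eP a) e) s (icost (eP a) + icost e).+1 post.
Proof.
move=> eq_q ea lt_x ee ps.
apply: (@run_iset _ _ _ _ _ _ (7 + (m + (h * m + x)))%N _ _ _ _ ee).
- by rewrite /= ea /= eq_q !addnA.
- by rewrite size_icells; lia.
rewrite /iwrite (set_nth_cat_shift _ [:: m; n; i; k; j; q; l] (_ ++ _)).
by rewrite set_nth_mkseq_shift set_nth_table_shift set_nth_mkseq_cat.
Qed.

Lemma run_L a e x y post : q = h -> ieval s a = Some x -> (x < h)%N ->
  ieval s e = Some y -> post (mem_state i k j q l J E P (upd L x y) X A C T) ->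
  run f (ISet (eL a) e) s (icost (eL a) + icost e).+1 post.
Proof.
move=> eq_q ea lt_x ee ps.
apply: (@run_iset _ _ _ _ _ _ (7 + (m + (h * m + (h + x))))%N _ _ _ _ ee).
- by rewrite /= ea /= eq_q !addnA.
- by rewrite size_icells; lia.
rewrite /iwrite (set_nth_cat_shift _ [:: m; n; i; k; j; q; l] (_ ++ _)).
by rewrite set_nth_mkseq_shift set_nth_table_shift set_nth_mkseq_shift set_nth_mkseq.
Qed.

Lemma run_X a e x (y : R) post : ieval s a = Some x -> (x < m)%N -> reval s e = Some y ->
  post (mem_state i k j q l J E P L (upd X x y) A C T) ->
  run f (RSet (eX a) e) s (icost (eX a) + rcost e).+1 post.
Proof.
move=> ea lt_x ee ps; apply: (@run_rset _ _ _ _ _ _ (m + x)%N _ _ _ _ ee).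
- by rewrite /= ea.
- by rewrite size_rcells; lia.
by rewrite /rwrite set_nth_mkseq_shift set_nth_mkseq_cat.
Qed.

Lemma run_A a b e x y z post : ieval s a = Some x -> ieval s b = Some y ->
  (x < h)%N -> (y < m)%N -> reval s e = Some z ->
  post (mem_state i k j q l J E P L X (upd2 A x y z) C T) ->
  run f (RSet (eA a b) e) s (icost (eA a b) + rcost e).+1 post.
Proof.
move=> ea eb lt_x lt_y ee ps.
apply: (@run_rset _ _ _ _ _ _ (m + (m + (x * m + y)))%N _ _ _ _ ee).
- by rewrite /= ea eb /= !addnA.
- by rewrite size_rcells; have := table_bound lt_x lt_y; lia.
by rewrite /rwrite !set_nth_mkseq_shift set_nth_table_cat.
Qed.

Lemma run_C a e x (y : R) post : q = h -> ieval s a = Some x -> (x < h)%N ->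
  reval s e = Some y -> post (mem_state i k j q l J E P L X A (upd C x y) T) ->
  run f (RSet (eC a) e) s (icost (eC a) + rcost e).+1 post.
Proof.
move=> eq_q ea lt_x ee ps.
apply: (@run_rset _ _ _ _ _ _ (m + (m + (h * m + x)))%N _ _ _ _ ee).
- by rewrite /= ea /= eq_q !addnA.
- by rewrite size_rcells; lia.
by rewrite /rwrite !set_nth_mkseq_shift set_nth_mkseq_cat.
Qed.

Lemma run_T a e x (y : R) post : q = h -> ieval s a = Some x -> (x < h)%N ->
  reval s e = Some y -> post (mem_state i k j q l J E P L X A C (upd T x y)) ->
  run f (RSet (eT a) e) s (icost (eT a) + rcost e).+1 post.
Proof.
move=> eq_q ea lt_x ee ps.
apply: (@run_rset _ _ _ _ _ _ (m + (m + (h * m + (h + x))))%N _ _ _ _ ee).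
- by rewrite /= ea /= eq_q !addnA.
- by rewrite size_rcells; lia.
rewrite /rwrite !set_nth_mkseq_shift.
by rewrite set_nth_mkseq.
Qed.

Lemma run_query_C a b x y (p : 'rV[R]_m) post : q = h -> ieval s a = Some x ->
  (x < h)%N -> ieval s b = Some y ->
  (forall t : 'I_m, onth (rcells s) (y + t) = Some (p 0 t)) ->
  post (mem_state i k j q l J E P L X A (upd C x (f p)) T) ->
  run f (Query (eC a) b) s (icost (eC a) + icost b).+1 post.
Proof.
move=> eq_q ea lt_x eb ep ps.
apply: (@run_query _ _ _ _ _ _ (m + (m + (h * m + x)))%N _ _ _ _ _ eb ep).
- by rewrite /= ea /= eq_q !addnA.
- by rewrite size_rcells; lia.
by rewrite /rwrite !set_nth_mkseq_shift set_nth_mkseq_cat.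
Qed.

End Regions.
End Memory.

Set Bullet Behavior "Strict Subproofs".

Declare Scope cmd_scope.
Delimit Scope cmd_scope with cmd.
Notation "c1 ;; c2" := (Seq c1 c2) (at level 61, right associativity) : cmd_scope.
Local Open Scope cmd_scope.

(** * Listing the exponents and the nodes *)

Definition copy_test := ILe (IAdd (cell 4) (IConst 1)) (cell 0).

(** Besides copying row i to row i + 1, the loop leaves in cell 3 the last index with a positive
    exponent, or 0 if there is none. *)
Definition copy_body :=
  ISet (eE (IAdd (cell 2) (IConst 1)) (cell 4)) (IGet (eE (cell 2) (cell 4))) ;;
  RSet (eA (IAdd (cell 2) (IConst 1)) (cell 4)) (RGet (eA (cell 2) (cell 4))) ;;
  If (ILe (IConst 1) (IGet (eE (cell 2) (cell 4)))) (ISet (IConst 3) (cell 4)) Skip ;;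
  ISet (IConst 4) (IAdd (cell 4) (IConst 1)).

(** Turns the copy into the successor. The last position is written last, so it overrides the zero
    at [k] when the two coincide; all values are read from the intact row i. The real table repeats
    the arithmetic, as integers cannot be converted. *)
Definition next_row :=
  ISet (eE (IAdd (cell 2) (IConst 1)) (cell 3)) (IConst 0) ;;
  RSet (eA (IAdd (cell 2) (IConst 1)) (cell 3)) RZero ;;
  If (ILe (IConst 1) (cell 3))
    (ISet (eE (IAdd (cell 2) (IConst 1)) (ISub (cell 3) (IConst 1)))
       (IAdd (IGet (eE (cell 2) (ISub (cell 3) (IConst 1)))) (IConst 1)) ;;
     RSet (eA (IAdd (cell 2) (IConst 1)) (ISub (cell 3) (IConst 1)))
       (RAdd (RGet (eA (cell 2) (ISub (cell 3) (IConst 1)))) ROne) ;;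
     ISet (eE (IAdd (cell 2) (IConst 1)) (ISub (cell 0) (IConst 1)))
       (ISub (IGet (eE (cell 2) (cell 3))) (IConst 1)) ;;
     RSet (eA (IAdd (cell 2) (IConst 1)) (ISub (cell 0) (IConst 1)))
       (RSub (RGet (eA (cell 2) (cell 3))) ROne))
    (ISet (eE (IAdd (cell 2) (IConst 1)) (ISub (cell 0) (IConst 1)))
       (IAdd (IGet (eE (cell 2) (cell 3))) (IConst 1)) ;;
     RSet (eA (IAdd (cell 2) (IConst 1)) (ISub (cell 0) (IConst 1)))
       (RAdd (RGet (eA (cell 2) (cell 3))) ROne)).

(** Stops at x_0^n, so the number of rows need not be known in advance. *)
Definition gen_test := ILe (IAdd (IGet (eE (cell 2) (IConst 0))) (IConst 1)) (cell 1).

Definition gen_body :=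
  ISet (IConst 3) (IConst 0) ;;
  ISet (IConst 4) (IConst 0) ;;
  While copy_test copy_body ;;
  next_row ;;
  ISet (IConst 2) (IAdd (cell 2) (IConst 1)).

Ltac side := first [reflexivity | assumption | lia].

(** Symbolic execution: [ev] evaluates expressions by the region lemmas and [step] runs a command.
    The time accumulates in an existential variable, which the final inequality of [run_le] compares
    with a generous constant. *)
Ltac ev := lazymatch goal with
  | |- ieval _ (IConst _) = _ => apply: ev_const
  | |- ieval _ (cell _) = _ => reflexivity
  | |- ieval _ (IAdd _ _) = _ => apply: ev_add; [ev|ev]
  | |- ieval _ (ISub _ _) = _ => apply: ev_sub; [ev|ev]
  | |- ieval _ (IGet (eE _ _)) = _ => apply: get_E; [ev|ev|side|side]
  | |- ieval _ (IGet (eJ _)) = _ => apply: get_J; [ev|side]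
  | |- ieval _ (IGet (eP _)) = _ => apply: get_P; [side|ev|side]
  | |- ieval _ (IGet (eL _)) = _ => apply: get_L; [side|ev|side]
  | |- reval _ RZero = _ => reflexivity
  | |- reval _ ROne = _ => reflexivity
  | |- reval _ (RAdd _ _) = _ => apply: rev_add; [ev|ev]
  | |- reval _ (RSub _ _) = _ => apply: rev_sub; [ev|ev]
  | |- reval _ (RMul _ _) = _ => apply: rev_mul; [ev|ev]
  | |- reval _ (RDiv _ _) = _ => apply: rev_div; [ev|ev|idtac]
  | |- reval _ (RGet (eX _)) = _ => apply: get_X; [ev|side]
  | |- reval _ (RGet (eA _ _)) = _ => apply: get_A; [ev|ev|side|side]
  | |- reval _ (RGet (eC _)) = _ => apply: get_C; [side|ev|side]
  | |- reval _ (RGet (eT _)) = _ => apply: get_T; [side|ev|side]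
  | |- reval _ (RGet _) = _ => apply: get_M; [ev|side]
  | |- teval _ (ILe _ _) = _ => apply: tev_le; [ev|ev]
  end.

Ltac tev := etransitivity; [ev | congr Some; lia].

Ltac step := cbv beta; lazymatch goal with
  | |- run _ (Seq _ _) _ _ _ => apply: run_seq
  | |- run _ (ISet (IConst 2) _) _ _ _ => apply: run_i; [ev|]
  | |- run _ (ISet (IConst 3) _) _ _ _ => apply: run_k; [ev|]
  | |- run _ (ISet (IConst 4) _) _ _ _ => apply: run_j; [ev|]
  | |- run _ (ISet (IConst 5) _) _ _ _ => apply: run_q; [ev|]
  | |- run _ (ISet (IConst 6) _) _ _ _ => apply: run_l; [ev|]
  | |- run _ (ISet (eE _ _) _) _ _ _ => apply: run_E; [ev|ev|side|side|ev|]
  | |- run _ (ISet (eJ _) _) _ _ _ => apply: run_J; [ev|side|ev|]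
  | |- run _ (ISet (eP _) _) _ _ _ => apply: run_P; [side|ev|side|ev|]
  | |- run _ (ISet (eL _) _) _ _ _ => apply: run_L; [side|ev|side|ev|]
  | |- run _ (RSet (eX _) _) _ _ _ => apply: run_X; [ev|side|ev|]
  | |- run _ (RSet (eA _ _) _) _ _ _ => apply: run_A; [ev|ev|side|side|ev|]
  | |- run _ (RSet (eC _) _) _ _ _ => apply: run_C; [side|ev|side|ev|]
  | |- run _ (RSet (eT _) _) _ _ _ => apply: run_T; [side|ev|side|ev|]
  | |- run _ (If _ _ _) _ _ _ =>
      let H := fresh "Hif" in apply: run_if; [ev|move=> H|move=> H]
  | |- run _ Skip _ _ _ => apply: run_skip
  end.

Section Generate.

Variables (R : realType) (m n : nat) (f : 'rV[R]_m -> R) (M : nat -> R).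
Hypothesis m_gt0 : (0 < m)%N.
Variables (l : nat) (J P L : nat -> nat) (X C T : nat -> R).

Notation h := (N m n).
Notation expo := (expo m n).
Notation st i k j q E A := (mem_state m n h M i k j q l J E P L X A C T).

Definition rows_ok (E : nat -> nat -> nat) (A : nat -> nat -> R) r :=
  forall i t, (i < r)%N -> (t < m)%N -> E i t = expo i t /\ A i t = (expo i t)%:R.

Lemma run_copy i E A : (i.+1 < h)%N -> rows_ok E A i.+1 ->
  run f (While copy_test copy_body) (st i 0 0 0 E A) (m * 200 + 10)
    (fun s => exists k E' A', [/\ s = st i k m 0 E' A', rows_ok E' A' i.+1,
       forall t, (t < m)%N -> E' i.+1 t = expo i t /\ A' i.+1 t = (expo i t)%:R,
       (k < m)%N &
       (forall t, (t < m)%N -> (k < t)%N -> expo i t = 0%N) /\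
       ((0 < k)%N -> (0 < expo i k)%N)]).
Proof.
move=> lt_i ok.
pose inv j s := exists k E' A', [/\ s = st i k j 0 E' A', rows_ok E' A' i.+1,
       forall t, (t < j)%N -> E' i.+1 t = expo i t /\ A' i.+1 t = (expo i t)%:R,
       (k < m)%N &
       (forall t, (t < j)%N -> (k < t)%N -> expo i t = 0%N) /\
       ((0 < k)%N -> (0 < expo i k)%N)].
apply: run_le; first apply: (run_for (inv := inv)).
- by exists 0%N, E, A; split.
- by move=> j s lt_j [k [E' [A' [-> ok' row lt_k [k1 k2]]]]]; rewrite /copy_test; tev.
- move=> j s lt_j [k [E' [A' [-> ok' row lt_k [k1 k2]]]]].
  have [eE eA] : E' i j = expo i j /\ A' i j = (expo i j)%:R by apply: ok'; lia.
  have ok2 : rows_ok (upd2 E' (i + 1)%N j (E' i j)) (upd2 A' (i + 1)%N j (A' i j)) i.+1.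
    move=> i' t lt_i' lt_t; rewrite /upd2.
    have -> : (i' == i + 1)%N = false by lia.
    exact: ok'.
  have row2 t : (t < j.+1)%N -> upd2 E' (i + 1)%N j (E' i j) i.+1 t = expo i t /\
      upd2 A' (i + 1)%N j (A' i j) i.+1 t = (expo i t)%:R.
    rewrite /upd2 addn1 eqxx /= ltnS leq_eqVlt; case: eqP => [-> _|_ /row //].
    by rewrite eE eA.
  have [eE2 _] := ok2 i j (ltnSn i) lt_j.
  rewrite /copy_body; do 5!step; do 3!step; rewrite /inv; do 3!eexists.
  all: split; [by rewrite (addn1 j)| exact: ok2|exact: row2| lia|split=> [t|]].
  all: rewrite ?eE2 in Hif *; try lia.
  move=> le_t lt_kt; have [eq_tj|ne_tj] := eqVneq t j; first by rewrite eq_tj; lia.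
  by apply: k1; lia.
- move=> s [k [E' [A' [-> _ _ _ _]]]]; rewrite /copy_test; tev.
- rewrite /=; lia.
Qed.

Lemma run_gen_body i k j E A : (i.+1 < h)%N -> rows_ok E A i.+1 ->
  run f gen_body (st i k j 0 E A) (m * 200 + 400)
    (fun s => exists k' j' E' A', s = st i.+1 k' j' 0 E' A' /\ rows_ok E' A' i.+2).
Proof.
move=> lt_i ok.
have [lt_n _] := expo_last n m_gt0; have lt_in := (expo_last n m_gt0).2 i lt_i.
apply: run_le.
- rewrite /gen_body; do 5!step.
  apply: run_post; first exact: (run_copy lt_i ok).
  move=> s [k1 [E1 [A1 [-> ok1 row lt_k [hi pos]]]]].
  have [eE eA] : E1 i k1 = expo i k1 /\ A1 i k1 = (expo i k1)%:R by apply: ok1.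
  have [eE' eA'] : E1 i (k1 - 1)%N = expo i (k1 - 1) /\
      A1 i (k1 - 1)%N = (expo i (k1 - 1))%:R by apply: ok1; lia.
  have [_ succ] := expo_succ (ltnW lt_i) lt_k lt_in hi pos.
  have ni : (i == i.+1) = false by lia.
  cbv beta; rewrite /next_row; do 20?step; do 4!eexists.
  all: split; first by rewrite (addn1 i).
  (* Earlier rows are untouched; the new row is compared with the successor formula, later writes
     taking precedence. *)
  all: move=> i' t; rewrite ltnS leq_eqVlt /upd2 !addn1 => /predU1P[->|lt_i'] lt_t;
    last by rewrite (ltn_eqF lt_i') /=; apply: ok1.
  all: rewrite eqxx ni /= !(succ t lt_t) eE eA ?eE' ?eA'.
  all: have -> : (m - 1 = m.-1)%N by rewrite subn1.
  + rewrite Hif /=; have -> : (t.+1 == k1) = (t == (k1 - 1)%N) by lia.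
    case: (t =P m.-1) => _; first by rewrite natrB ?pos.
    case: (t =P (k1 - 1)%N) => [->|_]; first by rewrite -natr1.
    by case: eqP => // _; apply: row.
  + have k0 : k1 = 0%N by lia.
    rewrite k0 /= in eE eA *.
    case: (t =P m.-1) => _; first by rewrite natr1.
    by case: eqP => // _; apply: row.
- by rewrite /=; lia.
Qed.

(** The zero memory already is the first row, so h - 1 passes suffice, and [N m n] is found as the
    final row index plus one. *)
Lemma run_gen E A : rows_ok E A 1 ->
  run f (While gen_test gen_body) (st 0 0 0 0 E A) (h * (m * 200 + 500))
    (fun s => exists k j E' A', s = st h.-1 k j 0 E' A' /\ rows_ok E' A' h).
Proof.
move=> ok; have h_gt0 := N_gt0 m n; have [last_n lt_n] := expo_last n m_gt0.
pose inv i s := exists k j E' A', s = st i k j 0 E' A' /\ rows_ok E' A' i.+1.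
apply: run_le.
- apply: run_post; first apply: (@run_for _ _ _ inv _ _ h.-1).
  + by exists 0%N, 0%N, E, A.
  + move=> i s lt_i [k [j [E' [A' [-> ok']]]]]; rewrite /gen_test.
    have [e0 _] : E' i 0%N = expo i 0 /\ A' i 0%N = (expo i 0)%:R by apply: ok'.
    by etransitivity; [ev|]; rewrite e0 addn1 lt_n //; lia.
  + move=> i s lt_i [k [j [E' [A' [-> ok']]]]]; apply: run_gen_body ok'; lia.
  + move=> s [k [j [E' [A' [-> ok']]]]]; rewrite /gen_test.
    have [e0 _] : E' h.-1 0%N = expo h.-1 0 /\ A' h.-1 0%N = (expo h.-1 0)%:R.
      by apply: ok'.
    by etransitivity; [ev|]; rewrite e0 last_n addn1 ltnn.
  + move=> s [k [j [E' [A' [-> ok']]]]]; exists k, j, E', A'; split=> //.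
    by rewrite prednK in ok'.
- by rewrite /= -{2}(prednK h_gt0) mulSn; lia.
Qed.

End Generate.

(** * Newton basis, monomial basis and the bases in between *)

Section Bases.

Variable R : realType.
Implicit Types (x a l : nat) (c : R).

Definition ffact_poly x a : R := \prod_(t < a) (x%:R - t%:R).

(* The value at the point [c + x] of the a-th element of the Newton basis with
   the nodes c, c + 1, ..., c + l - 1, 0, 0, ...; it is a falling factorial of
   x for [a <= l] and a monomial for [l = 0]. *)
Definition mixed_basis c l x a : R :=
  ffact_poly x (minn a l) * (c + x%:R) ^+ (a - l).

Lemma ffact_polyS x a : ffact_poly x a.+1 = ffact_poly x a * (x%:R - a%:R).
Proof. by rewrite /ffact_poly big_ord_recr. Qed.

Lemma ffact_poly_eq0 x a : (ffact_poly x a == 0) = (x < a)%N.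
Proof.
rewrite prodf_seq_eq0; apply/hasP/idP => [[t _ /andP[_]]|lt_xa].
  by rewrite subr_eq0 eqr_nat => /eqP ->.
by exists (Ordinal lt_xa); rewrite ?mem_index_enum //= subrr eqxx.
Qed.

Lemma mixed_basis_le c l x a : (a <= l)%N -> mixed_basis c l x a = ffact_poly x a.
Proof.
by move=> le_al; rewrite /mixed_basis (minn_idPl le_al) (eqP le_al) mulr1.
Qed.

Lemma mixed_basis0 c x a : mixed_basis c 0 x a = (c + x%:R) ^+ a.
Proof. by rewrite /mixed_basis minn0 subn0 /ffact_poly big_ord0 mul1r. Qed.

(** With y = c + x, raising the level replaces one factor y by x - l = y - (c + l). *)
Lemma mixed_basisS c l x a : (l < a)%N ->
  mixed_basis c l.+1 x a = mixed_basis c l x a - (c + l%:R) * mixed_basis c l x a.-1.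
Proof.
case: a => // a; rewrite ltnS => le_la; rewrite /mixed_basis /=.
rewrite !(minn_idPr _) ?(leq_trans le_la) // subSS ffact_polyS subSn // exprS.
by ring.
Qed.

End Bases.

Section TensorBases.

Variables (R : realType) (m n : nat) (M : nat -> R).
Notation h := (N m n).
Notation expo := (expo m n).
Notation pred_rank := (pred_rank m n).
Implicit Types (lev : nat -> nat).

(** The value of the j-th product basis element at the i-th translated node. Levels n on all axes
    give the Newton basis, levels 0 the monomials. *)
Definition tensor_basis lev j i : R :=
  \prod_(t < m) mixed_basis (M t) (lev t) (expo i t) (expo j t).

Notation newton := (tensor_basis (fun=> n)).

Lemma tensor_basisD1 lev k (lt_k : (k < m)%N) j i :
  tensor_basis lev j i = mixed_basis (M k) (lev k) (expo i k) (expo j k) *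
    \prod_(t < m | t != Ordinal lt_k) mixed_basis (M t) (lev t) (expo i t) (expo j t).
Proof. by rewrite /tensor_basis (bigD1 (Ordinal lt_k)). Qed.

Lemma eq_tensor_basis lev lev' j i :
  (forall t, (t < m)%N -> lev t = lev' t) ->
  tensor_basis lev j i = tensor_basis lev' j i.
Proof. by move=> eq_lev; apply: eq_bigr => t _; rewrite eq_lev. Qed.

Lemma newtonE j i : newton j i = \prod_(t < m) ffact_poly R (expo i t) (expo j t).
Proof. by apply: eq_bigr => t _; rewrite mixed_basis_le // expo_le. Qed.

Lemma newton0 i : newton 0 i = 1.
Proof. by rewrite newtonE big1 // => t _; rewrite expo0 /ffact_poly big_ord0. Qed.

Lemma newton_neq0 i : newton i i != 0.
Proof. by rewrite newtonE; apply/prodf_neq0 => t _; rewrite ffact_poly_eq0 ltnn. Qed.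

(** A nonzero value forces the exponents of [j] to be at most those of [i] on every axis, hence
    [j <= i]. *)
Lemma newton_eq0 i j : (i < j)%N -> (j < h)%N -> newton j i = 0.
Proof.
move=> lt_ij lt_j; apply: contraTeq lt_ij => nz; rewrite -leqNgt.
have [le_ij|lt_hi] := leqP h i; first exact: leq_trans (ltnW lt_j) le_ij.
apply: expo_le_leq lt_j lt_hi _ => k lt_k.
move: nz; rewrite newtonE => /prodf_neq0 /(_ (Ordinal lt_k) isT) /=.
by rewrite ffact_poly_eq0 -leqNgt.
Qed.

Lemma expo_pred_rank_neq k j t (lt_k : (k < m)%N) : (j < h)%N -> (0 < expo j k)%N ->
  (t : 'I_m) != Ordinal lt_k -> expo (pred_rank k j) t = expo j t.
Proof.
move=> lt_j gt0 ne_tk; rewrite ((expo_pred_rank lt_k lt_j gt0).2 t (ltn_ord t)).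
by move: ne_tk; rewrite -val_eqE /= => /negbTE ->; rewrite addn0.
Qed.

(** The last linear factor on axis [k], evaluated at node [i]; one multiplication thus yields each
    entry of a Newton row. *)
Lemma newton_pred_rank k j i : (k < m)%N -> (j < h)%N -> (0 < expo j k)%N ->
  newton j i = newton (pred_rank k j) i * ((expo i k)%:R - (expo j k)%:R + 1).
Proof.
move=> lt_k lt_j gt0; have [_ exk] := expo_pred_rank lt_k lt_j gt0.
rewrite !(tensor_basisD1 _ lt_k) [RHS]mulrAC; congr (_ * _); last first.
  by apply: eq_bigr => t ne_tk; rewrite (expo_pred_rank_neq (lt_k := lt_k)).
rewrite !mixed_basis_le ?expo_le // (exk k lt_k) eqxx addn1 ffact_polyS -natr1.
by congr (_ * _); ring.
Qed.

(** The levels during the conversion: axes before [k] are done, axis [k] has reached [l], the others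
    are still Newton. *)
Definition axis_level k l t := if (t < k)%N then 0%N else if t == k then l else n.

Lemma tensor_basis_lev_lt k l j i : (k < m)%N -> (j < h)%N -> (l < expo j k)%N ->
  tensor_basis (axis_level k l.+1) j i =
  tensor_basis (axis_level k l) j i -
  (M k + l%:R) * tensor_basis (axis_level k l) (pred_rank k j) i.
Proof.
move=> lt_k lt_j lt_l; have gt0 := leq_ltn_trans (leq0n l) lt_l.
have [_ exk] := expo_pred_rank lt_k lt_j gt0.
rewrite !(tensor_basisD1 _ lt_k) {1 3 5}/axis_level ltnn eqxx mixed_basisS //.
have -> : (expo j k).-1 = expo (pred_rank k j) k by rewrite (exk k lt_k) eqxx addn1.
rewrite mulrBl mulrA; congr (_ * _ - _ * _); apply: eq_bigr => t ne_tk;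
  rewrite ?(expo_pred_rank_neq (lt_k := lt_k)) // /axis_level;
  by move: ne_tk; rewrite -val_eqE /= => /negbTE ->.
Qed.

Lemma tensor_basis_lev_ge k l j i : (k < m)%N -> (expo j k <= l)%N ->
  tensor_basis (axis_level k l.+1) j i = tensor_basis (axis_level k l) j i.
Proof.
move=> lt_k le_l; apply: eq_bigr => t _; rewrite /axis_level.
case: ifP => // _; case: eqP => // ->.
by rewrite !mixed_basis_le // ltnW.
Qed.

End TensorBases.

(** * Newton coefficients by forward substitution *)

Definition point_test := ILe (IAdd (cell 3) (IConst 1)) (cell 0).

(** The counter at [k] holds [pred_rank k i] when axis [k] is visited. Any axis with a positive
    exponent yields a valid parent, so overwriting is harmless. *)
Definition point_body :=
  RSet (eX (cell 3)) (RAdd (RGet (cell 3)) (RGet (eA (cell 2) (cell 3)))) ;;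
  If (ILe (IConst 1) (IGet (eE (cell 2) (cell 3))))
    (ISet (eP (cell 2)) (IGet (eJ (cell 3))) ;;
     ISet (eL (cell 2)) (cell 3) ;;
     ISet (eJ (cell 3)) (IAdd (IGet (eJ (cell 3))) (IConst 1)))
    Skip ;;
  ISet (IConst 3) (IAdd (cell 3) (IConst 1)).

Definition solve_test := ILe (IAdd (cell 4) (IConst 1)) (cell 2).

(** The index is advanced between the two real writes: the term at j is subtracted, then the Newton
    value at j + 1 is obtained from its parent, whose index is at most j. *)
Definition solve_body :=
  RSet (eC (cell 2))
    (RSub (RGet (eC (cell 2))) (RMul (RGet (eC (cell 4))) (RGet (eT (cell 4))))) ;;
  ISet (IConst 4) (IAdd (cell 4) (IConst 1)) ;;
  RSet (eT (cell 4)) (RMul (RGet (eT (IGet (eP (cell 4)))))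
    (RAdd (RSub (RGet (eA (cell 2) (IGet (eL (cell 4)))))
                (RGet (eA (cell 4) (IGet (eL (cell 4)))))) ROne)).

Definition newton_test := ILe (IAdd (cell 2) (IConst 1)) (cell 5).

Definition newton_body :=
  ISet (IConst 3) (IConst 0) ;;
  While point_test point_body ;;
  Query (eC (cell 2)) (eX (IConst 0)) ;;
  RSet (eT (IConst 0)) ROne ;;
  ISet (IConst 4) (IConst 0) ;;
  While solve_test solve_body ;;
  RSet (eC (cell 2)) (RDiv (RGet (eC (cell 2))) (RGet (eT (cell 2)))) ;;
  ISet (IConst 2) (IAdd (cell 2) (IConst 1)).

Section Newton.

Variables (R : realType) (m n : nat) (f : 'rV[R]_m -> R) (M : nat -> R).
Hypothesis m_gt0 : (0 < m)%N.
Variables (l : nat) (E : nat -> nat -> nat) (A : nat -> nat -> R).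

Notation h := (N m n).
Notation expo := (expo m n).
Notation pred_rank := (pred_rank m n).
Notation newton := (tensor_basis m n M (fun=> n)).
Notation st i k j J P L X C T := (mem_state m n h M i k j h l J E P L X A C T).

Hypothesis EA_ok : rows_ok m n E A h.

Let tabE i t : (i < h)%N -> (t < m)%N -> E i t = expo i t.
Proof. by move=> lt_i lt_t; have [] := EA_ok lt_i lt_t. Qed.

Let tabA i t : (i < h)%N -> (t < m)%N -> A i t = (expo i t)%:R.
Proof. by move=> lt_i lt_t; have [] := EA_ok lt_i lt_t. Qed.

Definition node i : 'rV[R]_m := \row_t (M t + (expo i t)%:R).

Definition parent_ok (P L : nat -> nat) i :=
  [/\ (L i < m)%N, (0 < expo i (L i))%N & P i = pred_rank (L i) i].

Definition parents_ok P L r := forall i, (0 < i < r)%N -> parent_ok P L i.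

Lemma run_point i j J P L X C T : (i < h)%N ->
  parents_ok P L i -> (forall t, (t < m)%N -> J t = pred_rank t i) ->
  run f (While point_test point_body) (st i 0 j J P L X C T) (m * 200 + 10)
    (fun s => exists J' P' L' X', [/\ s = st i m j J' P' L' X' C T,
      parents_ok P' L' i.+1, forall t, (t < m)%N -> J' t = pred_rank t i.+1 &
      forall t, (t < m)%N -> X' t = M t + (expo i t)%:R]).
Proof.
move=> lt_i okP okJ.
(* The counters of the axes already visited include monomial [i], the others do not yet. *)
pose inv k s := exists J' P' L' X', [/\ s = st i k j J' P' L' X' C T,
  parents_ok P' L' i,
  forall t, (t < m)%N -> J' t = (pred_rank t i + ((t < k)%N && (0 < expo i t)%N))%N,
  forall t, (t < k)%N -> X' t = M t + (expo i t)%:R &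
  forall t, (t < k)%N -> (0 < expo i t)%N -> parent_ok P' L' i].
apply: run_le.
- apply: run_post; first apply: (@run_for _ _ _ inv _ _ m).
  + exists J, P, L, X; split=> // t lt_t; by rewrite okJ // addn0.
  + by move=> k s lt_k [J' [P' [L' [X' [-> _ _ _ _]]]]]; rewrite /point_test; tev.
  + move=> k s lt_k [J' [P' [L' [X' [-> okP' okJ' okX' ok]]]]].
    have eE := tabE lt_i lt_k; have eA := tabA lt_i lt_k.
    have okX2 t : (t < k.+1)%N -> upd X' k (M k + A i k) t = M t + (expo i t)%:R.
      by rewrite /upd ltnS leq_eqVlt; case: eqP => [-> _|_ /okX' //]; rewrite eA.
    rewrite /point_body; do 20?step; do 4!eexists.
    * split; first by rewrite (addn1 k).
      -- move=> i' /andP[i'_gt0 lt_i']; rewrite /parent_ok /upd (ltn_eqF lt_i').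
        by apply: okP'; rewrite i'_gt0.
      -- move=> t lt_t; rewrite /upd; case: eqP => [->|ne_tk].
          by rewrite okJ' // ltnn ltnSn -eE Hif addn0.
        by rewrite okJ' //; congr (_ + nat_of_bool (_ && _))%N; lia.
      -- exact: okX2.
      -- by move=> t _ _; rewrite /parent_ok /upd !eqxx -eE okJ' // ltnn addn0.
    * split; [by rewrite (addn1 k)|by []| |exact: okX2|].
      -- move=> t lt_t; rewrite okJ' //; congr (_ + nat_of_bool _)%N.
        have [->|ne_tk] := eqVneq t k; first by rewrite -eE Hif !andbF.
        by congr (_ && _); lia.
      -- move=> t; rewrite ltnS leq_eqVlt => /predU1P[->|lt_t]; last exact: ok.
        by rewrite -eE Hif.
  + by move=> s [J' [P' [L' [X' [-> _ _ _ _]]]]]; rewrite /point_test; tev.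
  + move=> s [J' [P' [L' [X' [-> okP' okJ' okX' ok]]]]].
    exists J', P', L', X'; split=> //.
      (* For positive [i] some exponent is positive, so a parent has been recorded. *)
      move=> i' /andP[i'_gt0]; rewrite ltnS leq_eqVlt => /predU1P[eq_i|lt_i'].
        have [|t lt_t gt0] := @expo_neq0 m n i; first by rewrite lt_i -eq_i i'_gt0.
        by rewrite eq_i; apply: ok lt_t gt0.
      by apply: okP'; rewrite i'_gt0.
    by move=> t lt_t; rewrite okJ' // lt_t pred_rankS.
- by rewrite /=; lia.
Qed.

Lemma run_solve i k J P L X C T : (i < h)%N -> parents_ok P L i.+1 -> T 0%N = 1 ->
  run f (While solve_test solve_body) (st i k 0 J P L X C T) (h * 200 + 10)
    (fun s => exists C' T', [/\ s = st i k i J P L X C' T',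
      forall j, (j < i)%N -> C' j = C j,
      C' i = C i - \sum_(0 <= j < i) C j * newton j i & T' i = newton i i]).
Proof.
move=> lt_i okP T0.
(* [T] is known up to [j] inclusive, so the diagonal entry needed for the division is present at the
   exit. *)
pose inv j s := exists C' T', [/\ s = st i k j J P L X C' T',
      forall j', (j' < i)%N -> C' j' = C j',
      C' i = C i - \sum_(0 <= j' < j) C j' * newton j' i &
      forall j', (j' <= j)%N -> T' j' = newton j' i].
apply: run_le.
- apply: run_post; first apply: (@run_for _ _ _ inv _ _ i).
  + exists C, T; split=> //; first by rewrite big_geq // subr0.
    by move=> j; rewrite leqn0 => /eqP ->; rewrite T0 newton0.
  + by move=> j s lt_j [C' [T' [-> _ _ _]]]; rewrite /solve_test; tev.
  + move=> j s lt_j [C' [T' [-> okC eqC okT]]].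
    have lt_jh : (j < h)%N by apply: ltn_trans lt_i.
    have lt_j1 : (j + 1 < h)%N by rewrite addn1 (leq_ltn_trans lt_j).
    have [|lt_L gt0 defP] := okP (j + 1)%N; first by rewrite addn1.
    have [lt_P _] := expo_pred_rank lt_L lt_j1 gt0.
    have lt_Ph : (P (j + 1)%N < h)%N by rewrite defP (ltn_trans lt_P).
    rewrite /solve_body; do 20?step; do 2!eexists; split; first by rewrite (addn1 j).
    * by move=> j' lt_j'; rewrite /upd (ltn_eqF lt_j') okC.
    * rewrite /upd eqxx eqC okC // okT // big_nat_recr //=.
      by rewrite opprD addrA.
    * move=> j'; rewrite /upd -(addn1 j) => le_j'; case: eqP => [->|ne_j'].
        rewrite okT ?defP; last by move: lt_P; lia.
        by rewrite !tabA // [RHS](newton_pred_rank _ _ lt_L lt_j1 gt0).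
      by apply: okT; lia.
  + by move=> s [C' [T' [-> _ _ _]]]; rewrite /solve_test; tev.
  + move=> s [C' [T' [-> okC eqC okT]]]; exists C', T'; split=> //.
    exact: okT.
- by rewrite /= leq_add // leq_mul //; lia.
Qed.

(** Later terms vanish at node [i], so the sum stops there and coefficients still to be computed do
    not enter. *)
Definition newton_ok C r := forall i, (i < r)%N ->
  \sum_(0 <= j < i.+1) C j * newton j i = f (node i).

Lemma run_newton k j J P L X C T : (forall t, (t < m)%N -> J t = 0%N) ->
  run f (While newton_test newton_body) (st 0 k j J P L X C T)
    (h * (m * 200 + h * 200 + 300) + 10)
    (fun s => exists k' j' J' P' L' X' C' T', 
       s = st h k' j' J' P' L' X' C' T' /\ newton_ok C' h).
Proof.
move=> J0.
pose inv i s := exists k' j' J' P' L' X' C' T',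
  [/\ s = st i k' j' J' P' L' X' C' T', newton_ok C' i, parents_ok P' L' i &
      forall t, (t < m)%N -> J' t = pred_rank t i].
apply: run_le.
- apply: run_post; first apply: (@run_for _ _ _ inv _ _ h).
  + exists k, j, J, P, L, X, C, T; split=> // [|t lt_t]; last by rewrite pred_rank0 J0.
    by move=> i; rewrite ltn0 andbF.
  + move=> i s lt_i [k' [j' [J' [P' [L' [X' [C' [T' [-> _ _ _]]]]]]]]].
    by rewrite /newton_test; tev.
  + move=> i s lt_i [k' [j' [J' [P' [L' [X' [C' [T' [-> okC okP okJ]]]]]]]]].
    rewrite /newton_body; do 3!step.
    apply: run_post; first exact: run_point lt_i okP okJ.
    move=> s1 [J1 [P1 [L1 [X1 [-> okP1 okJ1 okX1]]]]].
    step; apply: (run_query_C (p := node i)).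
    * by [].
    * by [].
    * by [].
    * by rewrite /eX; ev.
    * move=> t; rewrite /= addn0 onth_mkseq_shift onth_mkseq_cat // okX1 //.
      by rewrite mxE.
    * do 5!step.
      apply: run_post; first exact: run_solve lt_i okP1 _.
      move=> s2 [C2 [T2 [-> okC2 eqC2 eqT2]]].
      have {}okC2 j0 : (j0 < i)%N -> C2 j0 = C' j0.
        by move=> lt_j0; rewrite okC2 // /upd (ltn_eqF lt_j0).
      have {}eqC2 : C2 i = f (node i) - \sum_(0 <= j0 < i) C' j0 * newton j0 i.
        rewrite eqC2 /upd eqxx; congr (_ - _); apply: eq_big_nat => j0 /andP[_ lt_j0].
        by rewrite (ltn_eqF lt_j0).
      step; step; first by rewrite eqT2 newton_neq0.
      step; do 8!eexists; split; first by rewrite (addn1 i).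
      (* Equation [i] holds by the choice of the quotient; the earlier ones involve only unchanged
         coefficients. *)
      -- move=> i'; rewrite ltnS leq_eqVlt => /predU1P[->|lt_i'].
           rewrite big_nat_recr //= {2}/upd eqxx eqT2 divfK ?newton_neq0 // eqC2.
           rewrite addrC -[RHS](subrK (\sum_(0 <= j0 < i) C' j0 * newton j0 i)).
           congr (_ + _); apply: eq_big_nat => j0 /andP[_ lt_j0].
           by rewrite /upd (ltn_eqF lt_j0) okC2.
         rewrite -okC //; apply: eq_big_nat => j0 /andP[_ lt_j0].
         have lt_j0i : (j0 < i)%N by apply: leq_trans lt_i'.
         by rewrite /upd (ltn_eqF lt_j0i) okC2.
      -- exact: okP1.
      -- exact: okJ1.
  + move=> s [k' [j' [J' [P' [L' [X' [C' [T' [-> _ _ _]]]]]]]]].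
    by rewrite /newton_test; tev.
  + move=> s [k' [j' [J' [P' [L' [X' [C' [T' [-> okC _ _]]]]]]]]].
    by exists k', j', J', P', L', X', C', T'.
- rewrite /=; lia.
Qed.

End Newton.

(** * In-place conversion to the monomial basis *)

Definition row_test := ILe (IAdd (cell 2) (IConst 1)) (cell 5).

(** Cell 4 counts the earlier rows with a positive exponent on the axis, so it holds [pred_rank];
    the first cell of X holds mu_k + l. *)
Definition row_body :=
  If (ILe (IConst 1) (IGet (eE (cell 2) (cell 3))))
    (If (ILe (IAdd (cell 6) (IConst 1)) (IGet (eE (cell 2) (cell 3))))
       (RSet (eC (cell 4)) (RSub (RGet (eC (cell 4)))
          (RMul (RGet (eX (IConst 0))) (RGet (eC (cell 2)))))) Skip ;;
     ISet (IConst 4) (IAdd (cell 4) (IConst 1)))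
    Skip ;;
  ISet (IConst 2) (IAdd (cell 2) (IConst 1)).

Definition level_test := ILe (IConst 1) (cell 6).

Definition level_body :=
  ISet (IConst 6) (ISub (cell 6) (IConst 1)) ;;
  RSet (eX (IConst 0)) (RSub (RGet (eX (IConst 0))) ROne) ;;
  ISet (IConst 2) (IConst 0) ;;
  ISet (IConst 4) (IConst 0) ;;
  While row_test row_body.

Definition axis_test := ILe (IAdd (cell 3) (IConst 1)) (cell 0).

(** The real number n is read from the last row of A, which belongs to x_0^n. *)
Definition axis_body :=
  RSet (eX (IConst 0))
    (RAdd (RGet (cell 3)) (RGet (eA (ISub (cell 5) (IConst 1)) (IConst 0)))) ;;
  ISet (IConst 6) (cell 1) ;;
  While level_test level_body ;;
  ISet (IConst 3) (IAdd (cell 3) (IConst 1)).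

(** Substituting B_r = B'_r - x B'_p moves - x C_r to the coefficient of B'_p and changes nothing
    else. *)
Lemma sum_change_basis (R : realType) (h p r : nat) (x : R) (C B B' : nat -> R) :
  (p < h)%N -> (r < h)%N -> p != r -> (forall j, j != r -> B' j = B j) ->
  B r = B' r - x * B' p ->
  \sum_(j < h) upd C p (C p - x * C r) j * B' j = \sum_(j < h) C j * B j.
Proof.
move=> lt_p lt_r ne_pr eqB defB; pose p' := Ordinal lt_p; pose r' := Ordinal lt_r.
rewrite [LHS](bigD1 r') // [RHS](bigD1 r') //=.
rewrite (bigD1 p') // [in RHS](bigD1 p') //= /upd eqxx eq_sym (negbTE ne_pr) defB.
rewrite -(eqB _ ne_pr) !addrA; congr (_ + _); first by ring.
apply: eq_bigr => j /andP[ne_jr ne_jp]; rewrite -!val_eqE /= in ne_jr ne_jp.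
by rewrite (negbTE ne_jp) eqB.
Qed.

Section Conversion.

Variables (R : realType) (m n : nat) (f : 'rV[R]_m -> R) (M : nat -> R).
Hypothesis m_gt0 : (0 < m)%N.
Variables (E : nat -> nat -> nat) (A : nat -> nat -> R).
Variables (J P L : nat -> nat) (T : nat -> R).

Notation h := (N m n).
Notation expo := (expo m n).
Notation pred_rank := (pred_rank m n).
Notation basis := (tensor_basis m n M).
Notation lev := (axis_level n).
Notation st i k j l X C := (mem_state m n h M i k j h l J E P L X A C T).

Hypothesis EA_ok : rows_ok m n E A h.

Let tabE i t : (i < h)%N -> (t < m)%N -> E i t = expo i t.
Proof. by move=> lt_i lt_t; have [] := EA_ok lt_i lt_t. Qed.

Let tabA i t : (i < h)%N -> (t < m)%N -> A i t = (expo i t)%:R.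
Proof. by move=> lt_i lt_t; have [] := EA_ok lt_i lt_t. Qed.

(** The levels may depend on [j], because in the middle of a pass only the first elements have been
    replaced. *)
Definition expands (C : nat -> R) (lv : nat -> nat -> nat) := forall i, (i < h)%N ->
  \sum_(j < h) C j * basis (lv j) j i = f (node m n M i).

(** Here the increasing order matters: the parent precedes [r], so it is already at level [l], as
    the one-step relation requires. *)
Lemma expands_update k l r C : (k < m)%N -> (r < h)%N -> (l < expo r k)%N ->
  expands C (fun j => if (j < r)%N then lev k l else lev k l.+1) ->
  expands (upd C (pred_rank k r) (C (pred_rank k r) - (M k + l%:R) * C r))
    (fun j => if (j < r.+1)%N then lev k l else lev k l.+1).
Proof.
move=> lt_k lt_r lt_l exC i lt_i; rewrite -exC //.
have gt0 := leq_ltn_trans (leq0n l) lt_l.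
have [lt_p _] := expo_pred_rank lt_k lt_r gt0; have lt_ph := ltn_trans lt_p lt_r.
apply: (@sum_change_basis R h (pred_rank k r) r (M k + l%:R) C
  (fun j => basis (if (j < r)%N then lev k l else lev k l.+1) j i)
  (fun j => basis (if (j < r.+1)%N then lev k l else lev k l.+1) j i)).
- exact: lt_ph.
- exact: lt_r.
- by rewrite ltn_eqF.
- by move=> j ne_jr; rewrite ltnS leq_eqVlt (negbTE ne_jr).
- by rewrite ltnn ltnSn ltnS (ltnW lt_p) tensor_basis_lev_lt.
Qed.

Lemma expands_skip k l r C : (k < m)%N -> (expo r k <= l)%N ->
  expands C (fun j => if (j < r)%N then lev k l else lev k l.+1) ->
  expands C (fun j => if (j < r.+1)%N then lev k l else lev k l.+1).
Proof.
move=> lt_k le_l exC i lt_i; rewrite -exC //; apply: eq_bigr => j _.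
rewrite ltnS leq_eqVlt; case: eqP => [->|_] //=; rewrite ltnn.
by rewrite tensor_basis_lev_ge.
Qed.

Lemma eq_expands C lv lv' :
  (forall j t, (j < h)%N -> (t < m)%N -> lv j t = lv' j t) ->
  expands C lv -> expands C lv'.
Proof.
move=> eq_lv exC i lt_i; rewrite -exC //; apply: eq_bigr => j _.
by congr (_ * _); apply: eq_tensor_basis => t lt_t; rewrite eq_lv.
Qed.

Lemma run_rows k l X C : (k < m)%N -> X 0%N = M k + l%:R ->
  expands C (fun=> lev k l.+1) ->
  run f (While row_test row_body) (st 0 k 0 l X C) (h * 200 + 10)
    (fun s => exists j C', s = st h k j l X C' /\ expands C' (fun=> lev k l)).
Proof.
move=> lt_k X0 exC.
pose inv r s := exists C', s = st r k (pred_rank k r) l X C' /\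
  expands C' (fun j => if (j < r)%N then lev k l else lev k l.+1).
apply: run_le.
- apply: run_post; first apply: (@run_for _ _ _ inv _ _ h).
  + by exists C; rewrite pred_rank0.
  + by move=> r s lt_r [C' [-> _]]; rewrite /row_test; tev.
  + move=> r s lt_r [C' [-> exC']].
    have eE := tabE lt_r lt_k.
    have lt_p : (0 < expo r k)%N -> (pred_rank k r < h)%N.
      by move=> gt0; have [lt_pr _] := expo_pred_rank lt_k lt_r gt0; apply: ltn_trans lt_r.
    rewrite /row_body; do 2!step.
    * have gt0 : (0 < expo r k)%N by rewrite -eE.
      have {}lt_p := lt_p gt0.
      do 10?step; eexists; (split; first by rewrite (addn1 r) pred_rankS // gt0).
      -- by rewrite X0; apply: expands_update; rewrite // -eE -addn1.
      -- by apply: expands_skip; rewrite // -eE leqNgt -addn1 Hif0.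
    * do 10?step; eexists; split; first by rewrite (addn1 r) pred_rankS // -eE Hif addn0.
      by apply: expands_skip; rewrite // -eE leqNgt; move: Hif; lia.
  + by move=> s [C' [-> _]]; rewrite /row_test; tev.
  + move=> s [C' [-> exC']]; exists (pred_rank k h), C'; split=> //.
    by apply: eq_expands exC' => j t -> _.
- by rewrite /=; lia.
Qed.

Lemma run_levels i k j X C : (k < m)%N -> X 0%N = M k + n%:R ->
  expands C (fun=> lev k n) ->
  run f (While level_test level_body) (st i k j n X C) (n * (h * 200 + 100) + 10)
    (fun s => exists i' j' X' C', s = st i' k j' 0%N X' C' /\
      expands C' (fun=> lev k 0)).
Proof.
move=> lt_k X0 exC.
pose inv d s := exists i' j' X' C', [/\ s = st i' k j' (n - d)%N X' C',
  X' 0%N = M k + (n - d)%:R & expands C' (fun=> lev k (n - d))].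
apply: run_le.
- apply: run_post; first apply: (@run_for _ _ _ inv _ _ n).
  + by exists i, j, X, C; rewrite subn0.
  + by move=> d s lt_d [i' [j' [X' [C' [-> _ _]]]]]; rewrite /level_test; tev.
  + move=> d s lt_d [i' [j' [X' [C' [-> X'0 exC']]]]].
    have def_d : (n - d = (n - d.+1).+1)%N by lia.
    rewrite /level_body; step; step; step; step; step; step; step; step.
    have -> : (n - d - 1 = n - d.+1)%N by lia.
    apply: run_post; first apply: run_rows => //.
    * by rewrite /upd /= X'0 def_d -natr1; ring.
    * by rewrite -def_d.
    * move=> s1 [j1 [C1 [-> exC1]]]; do 4!eexists; split; [by []| |exact: exC1].
      by rewrite /upd /= X'0 def_d -natr1; ring.
  + by move=> s [i' [j' [X' [C' [-> _ _]]]]]; rewrite /level_test; tev.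
  + move=> s [i' [j' [X' [C' [-> _]]]]]; rewrite subnn => exC'.
    by exists i', j', X', C'.
- by rewrite /=; lia.
Qed.

Lemma run_axes i j l X C : expands C (fun _ _ => n) ->
  run f (While axis_test axis_body) (st i 0 j l X C)
    (m * (n * (h * 200 + 100) + 100) + 10)
    (fun s => exists i' j' l' X' C', s = st i' m j' l' X' C' /\
      expands C' (fun _ _ => 0%N)).
Proof.
move=> exC; have h_gt0 := N_gt0 m n; have [last_n _] := expo_last n m_gt0.
have lt_last : (h - 1 < h)%N by lia.
pose inv k s := exists i' j' l' X' C', s = st i' k j' l' X' C' /\
  expands C' (fun=> lev k n).
apply: run_le.
- apply: run_post; first apply: (@run_for _ _ _ inv _ _ m).
  + exists i, j, l, X, C; split=> //; apply: eq_expands exC => j' t _ lt_t.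
    by rewrite /axis_level ltn0; case: eqP.
  + by move=> k s lt_k [i' [j' [l' [X' [C' [-> _]]]]]]; rewrite /axis_test; tev.
  + move=> k s lt_k [i' [j' [l' [X' [C' [-> exC']]]]]].
    rewrite /axis_body; do 5!step.
    apply: run_post; first apply: run_levels exC' => //.
      by rewrite /upd /= tabA // subn1 last_n.
    move=> s1 [i1 [j1 [X1 [C1 [-> exC1]]]]]; step; do 5!eexists; split.
      by rewrite (addn1 k).
    (* Axis [k] at level 0 and axis [k + 1] at level [n] describe the same levels. *)
    apply: eq_expands exC1 => j2 t _ lt_t; rewrite /axis_level ltnS.
    by case: (ltngtP t k) => // lt_kt; case: eqP.
  + by move=> s [i' [j' [l' [X' [C' [-> _]]]]]]; rewrite /axis_test; tev.
  + move=> s [i' [j' [l' [X' [C' [-> exC']]]]]]; exists i', j', l', X', C'.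
    by split=> //; apply: eq_expands exC' => j2 t _ lt_t; rewrite /axis_level lt_t.
- by rewrite /=; lia.
Qed.

End Conversion.

(** * Interpolation as a Vandermonde system *)

Section Genericity.

Variables (R : realType) (m n : nat).
Implicit Types (P : 'I_(N m n) -> 'rV[R]_m) (Q : {mpoly R[m]}).

Lemma monomial_surj (a : 'X_{1..m < n.+1}) : exists j : 'I_(N m n), monomial j = a.
Proof.
exists (cast_ord (card_monomials m n) (enum_rank a)).
by rewrite /monomial cast_ordK enum_rankK.
Qed.

Lemma meval_monomial Q (v : 'I_m -> R) : (msize Q <= n.+1)%N ->
  Q.@[v] = \sum_(j < N m n) (\prod_(k < m) v k ^+ monomial j k) * Q@_(monomial j).
Proof.
move=> le_Q; rewrite {1}(mpolywE le_Q) raddf_sum /=.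
have bij : bijective (fun j => enum_val (cast_ord (esym (card_monomials m n)) j)).
  exists (fun a => cast_ord (card_monomials m n) (enum_rank a)) => a.
    by rewrite enum_valK cast_ordKV.
  by rewrite cast_ordK enum_rankK.
rewrite (reindex _ (onW_bij _ bij)); apply: eq_bigr => j _.
by rewrite mevalZ mevalX mulrC.
Qed.

Lemma interpolatesP (f : 'rV[R]_m -> R) P Q : (msize Q <= n.+1)%N ->
  interpolates f P Q <->
  Vandermonde_mx P *m (\col_j Q@_(monomial j)) = \col_i f (P i).
Proof.
move=> le_Q.
have eq_Q i : (Vandermonde_mx P *m (\col_j Q@_(monomial j))) i 0 = Q.@[P i 0].
  by rewrite mxE meval_monomial //; apply: eq_bigr => j _; rewrite !mxE.
split=> [[_ Qf]|/colP Qf]; first by apply/colP => i; rewrite eq_Q Qf mxE.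
by split=> // i; rewrite -eq_Q Qf mxE.
Qed.

(** The coefficient columns of the Lagrange polynomials, which interpolate the indicators of single
    nodes, form a right inverse. *)
Lemma generic_of_interpolation P : injective P ->
  (forall f : 'rV[R]_m -> R, exists Q, interpolates f P Q) -> generic_nodes P.
Proof.
move=> injP exQ.
have [Q Qf] := fin_all_exists (fun i => exQ (fun x => (x == P i)%:R)).
suff VQ : Vandermonde_mx P *m (\matrix_(j, i) (Q i)@_(monomial j)) = 1%:M.
  by have [] := mulmx1_unit VQ.
apply/matrixP => i i'.
have := (interpolatesP _ P (Qf i').1).1 (Qf i').
move=> /colP/(_ i); rewrite !mxE (inj_eq injP) => <-.
by apply: eq_bigr => j _; rewrite !mxE.
Qed.

Lemma interpolates_unique (f : 'rV[R]_m -> R) P Q :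
  generic_nodes P -> interpolates f P Q -> unique (interpolates f P) Q.
Proof.
move=> genP Qf; split=> // Q' Q'f; have [le_Q _] := Qf; have [le_Q' _] := Q'f.
have := (interpolatesP f P le_Q).1 Qf; rewrite -((interpolatesP f P le_Q').1 Q'f).
move=> /(congr1 (mulmx (invmx (Vandermonde_mx P)))); rewrite !mulKmx // => /colP eqQ.
rewrite (mpolywE le_Q) (mpolywE le_Q'); apply: eq_bigr => a _; congr (_ *: _).
by have [j <-] := monomial_surj a; have := eqQ j; rewrite !mxE.
Qed.

End Genericity.

(** * The whole algorithm and its cost *)

Definition interpolate :=
  If (ILe (cell 1) (IConst 0))
    (ISet (IConst 5) (IConst 1) ;; Query (eC (IConst 0)) (IConst 0))
    (While gen_test gen_body ;;
     ISet (IConst 5) (IAdd (cell 2) (IConst 1)) ;;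
     ISet (IConst 2) (IConst 0) ;;
     While newton_test newton_body ;;
     ISet (IConst 3) (IConst 0) ;;
     While axis_test axis_body).

(** Cell 0 is overwritten last, since the other two addresses are computed from m. The real exponent
    table itself is the node array. *)
Definition output :=
  ISet (IConst 1) (eC (IConst 0)) ;;
  ISet (IConst 2) (eE (IConst 0) (IConst 0)) ;;
  ISet (IConst 0) (IAdd (cell 0) (cell 0)).

Definition algorithm := interpolate ;; output.

Section Correctness.

Variables (R : realType) (m n : nat).
Hypothesis m_gt0 : (0 < m)%N.

Notation h := (N m n).
Notation expo := (expo m n).

(** The input cells come on top: m and n complete the seven scalar cells, and mu has its own
    region. *)
Definition int_cells := (5 + (m + (h * m + (h + h))))%N.
Definition real_cells := (m + (h * m + (h + h)))%N.

Definition coord (mu : 'rV[R]_m) i := nth 0 [seq mu 0 k | k <- enum 'I_m] i.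

Lemma coordE mu (k : 'I_m) : coord mu k = mu 0 k.
Proof. by rewrite /coord (nth_map k) ?size_enum_ord // nth_ord_enum. Qed.

Lemma mkseq_const (A : Type) (x : A) k : mkseq (fun=> x) k = nseq k x.
Proof.
apply: (@eq_from_nth _ x) => [|i]; rewrite size_mkseq ?size_nseq // => lt_i.
by rewrite nth_mkseq // nth_nseq lt_i.
Qed.

Lemma init_mem_state mu : init n mu int_cells real_cells =
  mem_state m n h (coord mu) 0 0 0 0 0 (fun=> 0%N) (fun _ _ => 0%N) (fun=> 0%N)
    (fun=> 0%N) (fun=> 0) (fun _ _ => 0) (fun=> 0) (fun=> 0).
Proof.
rewrite /init /mem_state /table !mkseq_const -!nseqD; congr State.
by congr (_ ++ _); rewrite -[LHS](mkseq_nth 0) size_map size_enum_ord.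
Qed.

Lemma N_n0 : N m 0 = 1%N.
Proof. by rewrite /N addn0 binn. Qed.

Lemma run_interpolate (f : 'rV[R]_m -> R) mu :
  run f interpolate (init n mu int_cells real_cells) (3000 * h ^ 2)
    (fun s => exists i k j l J E P L X A C T,
      [/\ s = mem_state m n h (coord mu) i k j h l J E P L X A C T,
        rows_ok m n E A h & expands n f (coord mu) C (fun _ _ => 0%N)]).
Proof.
have h_gt0 := N_gt0 m n.
have ok0 : rows_ok m n (fun _ _ => 0%N) (fun _ _ => 0 : R) 1.
  by move=> i t; rewrite ltnS leqn0 => /eqP -> _; rewrite expo0.
rewrite init_mem_state; have [n0|n_gt0] := posnP n.
{ have h1 : h = 1%N by rewrite n0 N_n0.
  apply: run_le.
  - apply: (run_if (v := true) (T2 := 0%N)) => [|_|//]; first by rewrite /= n0.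
    (* For [n = 0] the zero memory already is the only row, and its translated node is [mu], stored
       from address 0 on. *)
    do 2!step; apply: (run_query_C (p := mu)).
    + by rewrite h1.
    + by ev.
    + by [].
    + by ev.
    + by move=> t; rewrite /= add0n onth_mkseq_cat // coordE.
    + do 12!eexists; split; [by rewrite h1|by rewrite h1|].
      move=> i; rewrite -(big_mkord xpredT (fun j => upd _ _ _ j * tensor_basis m n _ _ j i)).
      rewrite h1 ltnS leqn0 => /eqP ->; rewrite big_nat1 /upd /= /tensor_basis big1.
        by rewrite mulr1; congr f; apply/rowP => t; rewrite mxE expo0 addr0 coordE.
      by move=> t _; rewrite mixed_basis0 expo0.
  - by rewrite h1. }
apply: run_le.
- apply: (run_if (v := false) (T1 := 0%N)) => [|//|_].
    by rewrite /= leqNgt n_gt0.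
  step; apply: run_post; first exact: run_gen.
  move=> s [k [j [E [A [-> okEA]]]]].
  do 4!step; cbv beta; rewrite addn1 prednK //; step.
  apply: run_post; first exact: run_newton.
  move=> s1 [k1 [j1 [J1 [P1 [L1 [X1 [C1 [T1 [-> okC]]]]]]]]].
  do 2!step; apply: run_post; first apply: run_axes => //.
    (* The triangular sum extends to all indices, the added Newton values being zero. *)
    move=> i lt_i; rewrite -okC //.
    rewrite -(big_mkord xpredT (fun j => C1 j * tensor_basis m n (coord mu) (fun=> n) j i)).
    rewrite (big_cat_nat (n := i.+1)) //= [X in _ + X]big_nat_cond.
    rewrite [X in _ + X]big1 ?addr0 // => j2 /andP[/andP[lt_ij lt_j] _].
    by rewrite newton_eq0 // mulr0.
  move=> s2 [i2 [j2 [l2 [X2 [C2 [-> exC2]]]]]].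
  by do 12!eexists; split; [by []| |exact: exC2].
(* Every term of the time bound is at most a multiple of h^2, by m n < h and, as n is positive here,
   m < h. *)
- have lt_mn : (m * n < h)%N by apply: leq_muln_N.
  have lt_m : (m < h)%N by apply: leq_ltn_trans lt_mn; rewrite leq_pmulr.
  have le_mh : (m * h <= h * h)%N by rewrite leq_mul2r ltnW ?orbT.
  have le_mnh : (m * n * h <= h * h)%N by rewrite leq_mul2r ltnW ?orbT.
  have le_hh : (h <= h * h)%N by rewrite leq_pmulr.
  rewrite expnS expn1 /= !(mulnDr, mulnDl) !mulnA.
  move: (N m n) lt_mn lt_m le_mh le_mnh le_hh h_gt0 => h'; lia.
Qed.

Lemma run_algorithm (f : 'rV[R]_m -> R) mu :
  run f algorithm (init n mu int_cells real_cells) (4000 * h ^ 2)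
    (fun s => exists k j l J E P L X A C T,
      [/\ s = State ([:: (m + m)%N; (m + m + h * m)%N; (7 + m)%N; k; j; h; l] ++
             (mkseq J m ++ (table E m h ++ (mkseq P h ++ mkseq L h))))
          (mkseq (coord mu) m ++ (mkseq X m ++ (table A m h ++ (mkseq C h ++ mkseq T h)))),
        rows_ok m n E A h & expands n f (coord mu) C (fun _ _ => 0%N)]).
Proof.
have h_gt0 := N_gt0 m n.
apply: run_le.
- rewrite /algorithm; step; apply: run_post; first exact: run_interpolate.
  move=> s [i [k [j [l [J [E [P [L [X [A [C [T [-> okEA exC]]]]]]]]]]]]].
  rewrite /output; step.
  apply: run_iset; [by []|by []|reflexivity|].
  step; apply: run_iset; [by []|by []|reflexivity|].
  apply: run_iset; [by []|by []|reflexivity|].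
  exists k, j, l, J, E, P, L, X, A, C, T; split=> //.
  by rewrite /iwrite /=; congr (State [:: _, _, _ & _] _); rewrite ?addn0.
- rewrite /=; have : (0 < h ^ 2)%N by rewrite expn_gt0 h_gt0.
  by move: (h ^ 2)%N => x; lia.
Qed.

End Correctness.

(** * The interpolating polynomial and the conclusion *)

Section Interpolation.

Variables (R : realType) (m n : nat).
Hypothesis m_gt0 : (0 < m)%N.

Notation h := (N m n).

Definition grid (i : 'I_h) : 'rV[R]_m := \row_k (expo m n i k)%:R.

Lemma grid_shift_inj mu : injective (fun i => grid i + mu).
Proof.
move=> i j /addIr/rowP eq_ij; apply/val_inj/(expo_inj (ltn_ord i) (ltn_ord j)) => k lt_k.
by have /eqP := eq_ij (Ordinal lt_k); rewrite !mxE eqr_nat => /eqP.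
Qed.

Definition bounded_mon (j : 'I_h) : 'X_{1..m < n.+1} :=
  BMultinom (mdeg_mon_nth m n j : (mdeg (mon_nth m n j) < n.+1)%N).

Lemma bounded_mon_bij : bijective bounded_mon.
Proof.
apply: inj_card_bij; last by rewrite card_monomials card_ord.
by move=> i j /(congr1 val) /= /mon_nth_inj eq_ij; apply/val_inj/eq_ij.
Qed.

Definition grid_poly (C : nat -> R) : {mpoly R[m]} :=
  \sum_(j < h) C j *: 'X_[bounded_mon j].

Lemma msize_grid_poly C : (msize (grid_poly C) <= n.+1)%N.
Proof.
apply: (leq_trans (msize_sum _ _ _)); apply/bigmax_leqP => j _.
apply: leq_trans (msizeZ_le _ _) _; rewrite msizeX.
exact: mdeg_mon_nth.
Qed.

Lemma mcoeff_grid_poly C j : (grid_poly C)@_(bounded_mon j) = C j.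
Proof.
rewrite raddf_sum (bigD1 j) //= big1 => [|i ne_ij].
  by rewrite addr0 mcoeffZ mcoeffX eqxx mulr1.
rewrite mcoeffZ mcoeffX (_ : (_ == _) = false) ?mulr0 //.
by apply: contraNF ne_ij => /eqP eq_ij; apply/eqP/(bij_inj bounded_mon_bij)/val_inj.
Qed.

Lemma interpolates_grid_poly (f : 'rV[R]_m -> R) mu C :
  expands n f (coord mu) C (fun _ _ => 0%N) ->
  interpolates f (fun i => grid i + mu) (grid_poly C).
Proof.
move=> exC; split=> [|i]; first exact: msize_grid_poly.
transitivity (f (node m n (coord mu) i)); last first.
  by congr f; apply/rowP => k; rewrite !mxE coordE addrC.
rewrite -exC // raddf_sum; apply: eq_bigr => j _.
rewrite /= mevalZ mevalX; congr (_ * _); apply: eq_bigr => k _.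
by rewrite mixed_basis0 !mxE coordE addrC -expoE.
Qed.

Lemma algorithm_correct (f : 'rV[R]_m -> R) mu :
  exists (Q : {mpoly R[m]}) t s,
    [/\ exec f algorithm (init n mu (int_cells m n) (real_cells m n)) t s,
        (t <= 4000 * h ^ 2)%N, outputs_nodes s grid, outputs_poly n s Q &
        interpolates f (fun i => grid i + mu) Q].
Proof.
have [t [s [ex_s le_t [k [j [l [J [E [P [L [X [A [C [T [def_s okEA exC]]]]]]]]]]]]]]] :=
  @run_algorithm R m n m_gt0 f mu.
exists (grid_poly C), t, s; split=> //.
- rewrite def_s; exists (m + m)%N => // i t0; rewrite -!addnA /=.
  rewrite !onth_mkseq_shift onth_table_cat //.
  by have [_ ->] := okEA i t0 (ltn_ord i) (ltn_ord t0); rewrite mxE.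
- rewrite def_s; exists (m + m + h * m)%N, (7 + m)%N, bounded_mon; split=> //.
  + exact: bounded_mon_bij.
  + move=> i t0; rewrite -!addnA /= add0n onth_mkseq_shift onth_table_cat //.
    by have [-> _] := okEA i t0 (ltn_ord i) (ltn_ord t0); rewrite expoE.
  + move=> i; rewrite -!addnA /= !onth_mkseq_shift onth_mkseq_cat //.
    by rewrite mcoeff_grid_poly.
- exact: interpolates_grid_poly.
Qed.

(** The correctness of the algorithm was shown without genericity, so it may be used to prove it. *)
Lemma generic_grid_shift mu : generic_nodes (fun i => grid i + mu).
Proof.
apply: generic_of_interpolation => [|f]; first exact: grid_shift_inj.
by have [Q [_ [_ [_ _ _ _ Qf]]]] := algorithm_correct f mu; exists Q.
Qed.

Lemma generic_grid : generic_nodes grid.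
Proof.
have := generic_grid_shift 0; rewrite /generic_nodes; congr (_ \in unitmx).
by apply/matrixP => i j; rewrite !mxE; apply: eq_bigr => k _; rewrite addr0.
Qed.

Lemma storage_init (mu : 'rV[R]_m) :
  (storage (init n mu (int_cells m n) (real_cells m n)) <= 16 * (m * h))%N.
Proof.
(* The total is 7 + 3 m + 2 h m + 4 h, and 16 = 7 + 3 + 2 + 4. *)
rewrite /storage /init /= !size_cat !size_nseq size_map size_enum_ord.
have le_m : (m <= h * m)%N by rewrite leq_pmull ?N_gt0.
have le_h : (h <= h * m)%N by rewrite leq_pmulr.
rewrite /int_cells /real_cells mulnC; move: m_gt0 le_m le_h; lia.
Qed.

End Interpolation.

Theorem mainTheorem2 (R : realType) :
  exists (algorithm : cmd) (Ct Cs : nat),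
    forall m n : nat, (1 <= m)%N ->
    exists (P : 'I_(N m n) -> 'rV[R]_m) (wi wr : nat),
      generic_nodes P /\
      forall (f : 'rV[R]_m -> R) (mu : 'rV[R]_m),
      exists (Q : {mpoly R[m]}) (t : nat) (s : state R),
        [/\ exec f algorithm (init n mu wi wr) t s,
            (t <= Ct * N m n ^ 2)%N,
            (storage (init n mu wi wr) <= Cs * (m * N m n))%N,
            outputs_nodes s P &
            outputs_poly n s Q /\
            unique (interpolates f (fun i => P i + mu)) Q].
Proof.
exists algorithm, 4000%N, 16%N => m n m_gt0.
exists (@grid R m n), (int_cells m n), (real_cells m n).
split=> [|f mu]; first exact: generic_grid.
have [Q [t [s [ex_s le_t out_P out_Q Qf]]]] := @algorithm_correct R m n m_gt0 f mu.
exists Q, t, s; split=> //; first exact: storage_init.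
split=> //; apply: interpolates_unique Qf; exact: generic_grid_shift.
Qed.
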